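(* There are spacelike Riemann ZMC examples in $\mathbb{L}^3$ foliated by circles contained in spacelike planes with parametrizations given in terms of elementary functions for the cases $\lambda=2$ and $\lambda=-2$. Let $\Pi$ be the plane $x_2=0$. (1) Case $\lambda=2$. The surface is $$X(r,v)=(-r+\arctan r,0,\arctan r)+r(\cos v,\sin v,0),$$ where $r>0$, $v\in(0,2\pi)$. The properties of this surface are the following. (a) The circles of the foliation are punctured. (b) The surface is contained in the horizontal slab $0<x_3\le\pi/2$. (c) The surface converges to a conelike point as $x_3\to0$ and converges to a straight line $L$ orthogonal to the plane $\Pi$ as $x_3\to\pi/2$. The straight line $L$ is contained in the surface. (d) The surface is asymptotic to the horizontal plane $x_3=\pi/2$. (e) The surface can be extended to a lightlike straight line. (2) Case $\lambda=-2$. The surface is $$X(r,v)=\left(-r-\tfrac12\log\left(\tfrac{r-1}{r+1}\right),0,\tfrac12\log\left(\tfrac{r-1}{r+1}\right)\right)+r(\cos v,\sin v,0),$$ where $r\in[r_0,\infty)$ for any $r_0>1$ and $\cos v<1-2/r^2$. The properties of this surface are the following. (a) The surface is foliated by pieces of circles that can be extended to full circles, assuming that the surface is degenerate at the points $\cos v=1-2/r^2$ and timelike when $\cos v>1-2/r^2$. (b) The surface is contained in the horizontal slab $z_0\le x_3<0$, where $z_0=\frac12\log\left(\frac{r_0-1}{r_0+1}\right)$. (c) If $r=r_0$, the surface has a boundary component that is (part of) a circle, and it converges to a straight line orthogonal to the plane $\Pi$ as $x_3\to0$. This straight line is contained in the surface.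
   Context: $\mathbb{L}^3$ is $\mathbb{R}^3$ with the metric $\langle,\rangle=dx_1^2+dx_2^2-dx_3^2$. A surface or plane is spacelike, timelike or degenerate (lightlike) where the induced metric is Riemannian, Lorentzian or degenerate; a straight line is lightlike if its direction $\vec v\ne0$ satisfies $\langle\vec v,\vec v\rangle=0$. The mean curvature $H$ is the trace of the second fundamental form; zero mean curvature (ZMC) means $H=0$. Circles in planes $x_3=\text{const}$ are Euclidean circles. A Riemann ZMC example is a non-rotational surface with zero mean curvature foliated by pieces of circles contained in parallel planes. The parameter $\lambda$ labels the members of the family $X(q,v)=(-m(q),0,z(q))+\sqrt q(\cos v,\sin v,0)$ with $z'(q)=\frac{1}{2\sqrt{q^3+\lambda q^2+q}}$ and $m'(q)=\frac{q}{2\sqrt{q^3+\lambda q^2+q}}$, and $r=\sqrt q$ is the radius. ''Horizontal'' means parallel to $x_3=0$. Convergence of the surface to a point or straight line as $x_3\to h$ refers to the limit of the horizontal leaves of the foliation; limit straight lines (obtained as $r\to\infty$) are regarded as contained in the surface. A conelike point is a point to which the circles shrink and at which the surface looks like a half light cone. A punctured circle is a circle with one point removed. ''Extended to a lightlike straight line'' means that the excluded points ($\cos v=1$) can be adjoined, and they are points of degenerate metric lying on a lightlike straight line.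
   Formalization: In (2a) points with cos v = 1 are degenerate, not timelike, so they are excluded from the timelike claim. In (2b) the limit line is excluded. In (2c) convergence to and containment of the whole line hold for the surface with full circles; spacelike leaves converge only to |x2| ≥ 2. *)

(* Defs.v *)
From Stdlib Require Export Reals.
From Coquelicot Require Export Coquelicot.

Open Scope R_scope.

Definition V3 : Type := (R * R * R)%type.

Definition x1 (p : V3) : R := fst (fst p).
Definition x2 (p : V3) : R := snd (fst p).
Definition x3 (p : V3) : R := snd p.

Definition lor (u w : V3) : R := x1 u * x1 w + x2 u * x2 w - x3 u * x3 w.

(* Lorentzian vector product: [lor (cross u v) w] is the determinant of
   [u], [v], [w]. *)
Definition cross (u v : V3) : V3 :=
  (x2 u * x3 v - x3 u * x2 v,
   x3 u * x1 v - x1 u * x3 v,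
   - (x1 u * x2 v - x2 u * x1 v)).

Definition span2 (u v : V3) : V3 -> Prop :=
  fun w => exists a b : R, w = plus (scal a u) (scal b v).

Definition independent2 (u v : V3) : Prop :=
  forall a b : R, plus (scal a u) (scal b v) = (zero : V3) -> a = 0 /\ b = 0.

Definition spacelike_subspace (P : V3 -> Prop) : Prop :=
  forall w : V3, P w -> w <> (zero : V3) -> 0 < lor w w.

Definition degenerate_subspace (P : V3 -> Prop) : Prop :=
  exists w : V3,
    P w /\ w <> (zero : V3) /\ (forall w' : V3, P w' -> lor w w' = 0).

(* For a plane, a nondegenerate indefinite form has signature (1,1). *)
Definition timelike_subspace (P : V3 -> Prop) : Prop :=
  ~ degenerate_subspace P /\
  (exists w : V3, P w /\ lor w w < 0) /\
  (exists w : V3, P w /\ 0 < lor w w).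

Definition horizontal : V3 -> Prop := fun w => x3 w = 0.

Definition line (p u : V3) : V3 -> Prop :=
  fun q => exists s : R, q = plus p (scal s u).

Definition is_line (L : V3 -> Prop) : Prop :=
  exists p u : V3, u <> (zero : V3) /\ (forall q, L q <-> line p u q).

Definition is_lightlike_line (L : V3 -> Prop) : Prop :=
  exists p u : V3,
    u <> (zero : V3) /\ lor u u = 0 /\ (forall q, L q <-> line p u q).

Definition plane_Pi : V3 -> Prop := fun p => x2 p = 0.

Definition is_line_orthogonal_to (P L : V3 -> Prop) : Prop :=
  exists p u : V3,
    u <> (zero : V3) /\ (forall q, L q <-> line p u q) /\
    (forall q q' : V3, P q -> P q' -> lor u (minus q q') = 0).

Definition hcircle (c : V3) (rho : R) : V3 -> Prop :=
  fun p => x3 p = x3 c /\ (x1 p - x1 c) ^ 2 + (x2 p - x2 c) ^ 2 = rho ^ 2.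

Definition is_hcircle (A : V3 -> Prop) : Prop :=
  exists (c : V3) (rho : R),
    0 < rho /\ (forall p, A p <-> hcircle c rho p).

Definition is_punctured_hcircle (A : V3 -> Prop) : Prop :=
  exists (c : V3) (rho : R) (p0 : V3),
    0 < rho /\ hcircle c rho p0 /\
    (forall p, A p <-> hcircle c rho p /\ p <> p0).

Definition is_hcircle_arc (A : V3 -> Prop) : Prop :=
  exists (c : V3) (rho a b : R),
    0 < rho /\ a < b /\
    (forall p, A p <->
       exists t : R, a < t < b /\
         p = plus c (scal rho ((cos t, sin t, 0) : V3))).

(* A surface is given by a total map [X] and the domain [D] of its
   parameters. *)

Definition image (X : R -> R -> V3) (D : R -> R -> Prop) : V3 -> Prop :=
  fun p => exists u v : R, D u v /\ p = X u v.

(* The total operator [Derive] is meaningful under the smoothness assumption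
   [smooth_map] below. *)
Definition d1 (X : R -> R -> V3) (u v : R) : V3 :=
  (Derive (fun s => x1 (X s v)) u,
   Derive (fun s => x2 (X s v)) u,
   Derive (fun s => x3 (X s v)) u).

Definition d2 (X : R -> R -> V3) (u v : R) : V3 :=
  (Derive (fun s => x1 (X u s)) v,
   Derive (fun s => x2 (X u s)) v,
   Derive (fun s => x3 (X u s)) v).

Fixpoint Ck (k : nat) (D : R -> R -> Prop) (f : R -> R -> R) : Prop :=
  (forall u v, D u v -> continuity_2d_pt f u v) /\
  match k with
  | O => True
  | S k' =>
      (forall u v, D u v ->
         ex_derive (fun s => f s v) u /\ ex_derive (fun s => f u s) v) /\
      Ck k' D (fun u v => Derive (fun s => f s v) u) /\
      Ck k' D (fun u v => Derive (fun s => f u s) v)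
  end.

Definition smooth_map (X : R -> R -> V3) (D : R -> R -> Prop) : Prop :=
  forall k : nat,
    Ck k D (fun u v => x1 (X u v)) /\
    Ck k D (fun u v => x2 (X u v)) /\
    Ck k D (fun u v => x3 (X u v)).

Definition tangent_plane (X : R -> R -> V3) (u v : R) : V3 -> Prop :=
  span2 (d1 X u v) (d2 X u v).

Definition immersed_at (X : R -> R -> V3) (u v : R) : Prop :=
  independent2 (d1 X u v) (d2 X u v).

Definition spacelike_at (X : R -> R -> V3) (u v : R) : Prop :=
  spacelike_subspace (tangent_plane X u v).

Definition timelike_at (X : R -> R -> V3) (u v : R) : Prop :=
  timelike_subspace (tangent_plane X u v).

Definition degenerate_at (X : R -> R -> V3) (u v : R) : Prop :=
  degenerate_subspace (tangent_plane X u v).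

Definition unit_normal (X : R -> R -> V3) (u v : R) : V3 :=
  let n := cross (d1 X u v) (d2 X u v) in
  scal (/ sqrt (Rabs (lor n n))) n.

(* Trace, with respect to the induced metric, of the second fundamental form
   [(w,w') |-> lor (D_w w') N].  It has geometric meaning only at points where
   the metric is nondegenerate. *)
Definition mean_curvature (X : R -> R -> V3) (u v : R) : R :=
  let Xu := d1 X u v in
  let Xv := d2 X u v in
  let N := unit_normal X u v in
  let E := lor Xu Xu in
  let F := lor Xu Xv in
  let G := lor Xv Xv in
  let h11 := lor (d1 (d1 X) u v) N in
  let h12 := lor (d1 (d2 X) u v) N in
  let h22 := lor (d2 (d2 X) u v) N in
  (G * h11 - 2 * F * h12 + E * h22) / (E * G - F ^ 2).

(* A nontrivial one-parameter group of isometries fixing a line pointwise;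
   the line may have any causal character. *)
Definition rotation_group (rho : R -> V3 -> V3) : Prop :=
  (forall p, rho 0 p = p) /\
  (forall s t p, rho (s + t) p = rho s (rho t p)) /\
  (forall t p q,
     lor (minus (rho t p) (rho t q)) (minus (rho t p) (rho t q)) =
     lor (minus p q) (minus p q)) /\
  (forall p t, ex_derive (fun s => rho s p : V3) t) /\
  (exists L, is_line L /\ (forall p t, L p -> rho t p = p)) /\
  (exists t p, rho t p <> p).

(* Local invariance, tested at interior points of the domain only: a piece of
   a surface of revolution counts as rotational, whatever its boundary. *)
Definition rotational (X : R -> R -> V3) (D : R -> R -> Prop) : Prop :=
  exists rho, rotation_group rho /\
    forall u v : R,
      locally ((u, v) : R * R) (fun w : R * R => D (fst w) (snd w)) ->
      exists eps : R, 0 < eps /\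
        forall t : R, Rabs t < eps -> image X D (rho t (X u v)).

Definition leaf (S : V3 -> Prop) (h : R) : V3 -> Prop :=
  fun p => S p /\ x3 p = h.

Definition foliated_by_hcircle_arcs (S : V3 -> Prop) : Prop :=
  forall p, S p -> is_hcircle_arc (leaf S (x3 p)).

(* Riemann ZMC example whose parallel planes are horizontal. *)
Definition riemann_zmc_example
    (X : R -> R -> V3) (D : R -> R -> Prop) : Prop :=
  smooth_map X D /\
  (forall u v, D u v ->
     immersed_at X u v /\ ~ degenerate_at X u v /\ mean_curvature X u v = 0) /\
  ~ rotational X D /\
  foliated_by_hcircle_arcs (image X D).

(* [X], whose first parameter is the radius [r = sqrt q], is the member of
   parameter [lam] of the family
   (-m(q), 0, z(q)) + sqrt q (cos v, sin v, 0), for [q] in [I]. *)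
Definition family_member
    (lam : R) (I : R -> Prop) (X : R -> R -> V3) : Prop :=
  exists m z : R -> R,
    forall q : R, I q ->
      is_derive z q (1 / (2 * sqrt (q ^ 3 + lam * q ^ 2 + q))) /\
      is_derive m q (q / (2 * sqrt (q ^ 3 + lam * q ^ 2 + q))) /\
      forall v : R,
        X (sqrt q) v =
        plus ((- m q, 0, z q) : V3) (scal (sqrt q) ((cos v, sin v, 0) : V3)).

(* Kuratowski convergence of the sets [A t] to the set [L] along [F]. *)
Definition set_converges
    (A : R -> V3 -> Prop) (F : (R -> Prop) -> Prop) (L : V3 -> Prop) : Prop :=
  (forall p, L p -> forall eps : R, 0 < eps ->
     F (fun t => exists q, A t q /\ ball p eps q)) /\
  (forall p, ~ L p -> exists eps : R, 0 < eps /\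
     F (fun t => forall q, A t q -> ~ ball p eps q)).

(* Straight lines obtained as limits of the circles when the first parameter
   (the radius) tends to infinity; they are regarded as part of the surface. *)
Definition limit_line
    (X : R -> R -> V3) (D : R -> R -> Prop) (L : V3 -> Prop) : Prop :=
  is_line L /\
  set_converges (fun r p => exists v, D r v /\ p = X r v)
    (Rbar_locally p_infty) L.

Definition image_with_limit_lines
    (X : R -> R -> V3) (D : R -> R -> Prop) : V3 -> Prop :=
  fun p => image X D p \/ exists L, limit_line X D L /\ L p.

Definition half_light_cone : V3 -> Prop :=
  fun w => lor w w = 0 /\ 0 <= x3 w.

(* The leaves shrink to [p] as the height decreases to [h], and the blow-ups
   of [S] at [p] converge to a half light cone. *)
Definition converges_to_conelike_point
    (S : V3 -> Prop) (h : R) (p : V3) : Prop :=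
  (forall eps : R, 0 < eps ->
     at_right h (fun h' =>
       (exists q, leaf S h' q) /\ (forall q, leaf S h' q -> ball p eps q))) /\
  set_converges (fun t w => S (plus p (scal t w))) (at_right 0)
    half_light_cone.

Definition asymptotic_to (S P : V3 -> Prop) : Prop :=
  (forall M : R, exists p : V3, S p /\ M < norm p) /\
  (forall eps : R, 0 < eps -> exists M : R,
     forall p : V3, S p -> M < norm p -> exists q, P q /\ ball p eps q).

(* Image of the boundary points of the domain that belong to the domain. *)
Definition surface_boundary
    (X : R -> R -> V3) (D : R -> R -> Prop) : V3 -> Prop :=
  fun p => exists u v : R,
    D u v /\
    ~ locally ((u, v) : R * R) (fun w : R * R => D (fst w) (snd w)) /\
    p = X u v.

Definition X_plus (r v : R) : V3 :=
  plus ((- r + atan r, 0, atan r) : V3)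
       (scal r ((cos v, sin v, 0) : V3)).

Definition dom_plus (r v : R) : Prop := 0 < r /\ 0 < v < 2 * PI.
Definition dom_plus_full (r v : R) : Prop := 0 < r.

Definition X_minus (r v : R) : V3 :=
  plus ((- r - / 2 * ln ((r - 1) / (r + 1)), 0,
         / 2 * ln ((r - 1) / (r + 1))) : V3)
       (scal r ((cos v, sin v, 0) : V3)).

Definition dom_minus (r0 r v : R) : Prop := r0 <= r /\ cos v < 1 - 2 / r ^ 2.
Definition dom_minus_full (r0 r v : R) : Prop := r0 <= r.

(* Main.v *)
Require Import Defs.
From Stdlib Require Import Lra FunctionalExtensionality.

Open Scope R_scope.

(** Both surfaces have the form
    X(r,v) = (e z(r) - r + r cos v, r sin v, z(r)) with e = +1 or -1 and
    z'(r) = 1 / (r^2 + e).  The determinant of the first fundamental form is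
    r^4 z'^2 (1 - cos v) (r^2 (1 - cos v) + 2 e), which gives the causal
    characters, and the numerator of H is a multiple of
    (1 - r^2 z')^2 - z'^2 = (e^2 - 1) z'^2 = 0.  Writing R for the inverse of z,
    the leaves satisfy (x1 - e x3)^2 + 2 (x1 - e x3) R(x3) + x2^2 = 0; hence a
    bounded part of a leaf of large radius is close to the line
    x1 = e x3, x3 = lim z.  If the surface were rotational, the Killing field of
    the group would be tangent to it; on each leaf this is a quadratic
    polynomial in (cos v, sin v) that vanishes on an arc, so its coefficients
    vanish, and two leaves of different radius force the Killing field to be
    zero. *)

(** Both determinant factors matter for the shape of the domains. The factor [1 - cos v] vanishes at
    one point of every circle, namely [(e z, 0, z)], which runs along the lightlike direction
    [(e, 0, 1)]. The factor [r^2 (1 - cos v) + 2 e] is positive for [e = 1], so that only this point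
    is lost, but for [e = -1] it cuts off a whole arc around it. That arc is the part of the circle
    nearest to the limit line. Hence for [e = -1] only the full circles converge to the entire line,
    while the spacelike arcs reach just its points with [|x2| >= 2]. For this reason a bound
    [c < k r] on the cosine is carried along, and limits are computed with a prescribed set of
    admissible [x2]. Invariance under a rotation group is available only for small times and at
    interior points. It is therefore used infinitesimally, and only on the half circles
    [cos v <= 0], which at large radii lie inside both domains. The heights enter only through their
    derivative and their inverse, so that arctangent and logarithm are treated alike. *)

(* Heights [z] as functions of the radius: [e = 1], [a = 0] for lambda = 2 and
   [e = -1], [a = 1] for lambda = -2. *)
Definition profile (e a : R) (z : R -> R) : Prop :=
  e ^ 2 = 1 /\
  forall r, a < r -> 0 < r /\ 0 < r ^ 2 + e /\ is_derive z r (/ (r ^ 2 + e)).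

Definition RX (e : R) (z : R -> R) (r v : R) : V3 :=
  (e * z r - r + r * cos v, r * sin v, z r).

(** * Derivatives of the common parametrization and its mean curvature *)

Lemma Derive_eq_on_ray (f g : R -> R) (a r : R) :
  a < r -> (forall s, a < s -> f s = g s) -> Derive f r = Derive g r.
Proof.
intros ar fg. apply Derive_ext_loc.
assert (d : 0 < r - a) by lra. exists (mkposreal _ d). intros s Hs.
apply fg. apply Rabs_lt_between' in Hs. simpl in Hs. lra.
Qed.

Lemma d1_RX (e a : R) (z : R -> R) (r v : R) : profile e a z -> a < r ->
  d1 (RX e z) r v =
  (cos v - r ^ 2 * / (r ^ 2 + e), sin v, / (r ^ 2 + e)).
Proof.
intros [e2 Hz] ar. destruct (Hz r ar) as (r0 & w0 & dz).
unfold d1, RX, x1, x2, x3; simpl.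
repeat f_equal.
- apply is_derive_unique.
  auto_derive; [exists (/ (r ^ 2 + e)); exact dz|].
  replace (Derive (fun x => z x) r) with (/ (r ^ 2 + e))
    by (symmetry; apply is_derive_unique; exact dz).
  simpl in w0. field. lra.
- apply is_derive_unique. auto_derive; auto. ring.
- apply is_derive_unique. exact dz.
Qed.

Lemma d2_RX (e : R) (z : R -> R) (r v : R) :
  d2 (RX e z) r v = (- r * sin v, r * cos v, 0).
Proof.
unfold d2, RX, x1, x2, x3; simpl.
repeat f_equal; apply is_derive_unique; auto_derive; auto; ring.
Qed.

Lemma d11_RX (e a : R) (z : R -> R) (r v : R) : profile e a z -> a < r ->
  d1 (d1 (RX e z)) r v =
  (- 2 * e * r * / (r ^ 2 + e) ^ 2, 0, - 2 * r * / (r ^ 2 + e) ^ 2).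
Proof.
intros Hz ar. destruct (proj2 Hz r ar) as (r0 & w0 & dz).
unfold d1 at 1; repeat f_equal.
- rewrite (Derive_eq_on_ray _ (fun s => cos v - s ^ 2 * / (s ^ 2 + e)) a r ar)
    by (intros s Hs; rewrite (d1_RX e a); auto).
  apply is_derive_unique; auto_derive; simpl in w0 |- *; [lra|field; lra].
- rewrite (Derive_eq_on_ray _ (fun _ => sin v) a r ar)
    by (intros s Hs; rewrite (d1_RX e a); auto).
  apply Derive_const.
- rewrite (Derive_eq_on_ray _ (fun s => / (s ^ 2 + e)) a r ar)
    by (intros s Hs; rewrite (d1_RX e a); auto).
  apply is_derive_unique; auto_derive; simpl in w0 |- *; [lra|field; lra].
Qed.

Lemma d12_RX (e : R) (z : R -> R) (r v : R) :
  d1 (d2 (RX e z)) r v = (- sin v, cos v, 0).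
Proof.
unfold d1; repeat f_equal; apply is_derive_unique;
  (eapply is_derive_ext; [intros s; rewrite d2_RX; reflexivity|]);
  unfold x1, x2, x3; simpl; auto_derive; auto; ring.
Qed.

Lemma d22_RX (e : R) (z : R -> R) (r v : R) :
  d2 (d2 (RX e z)) r v = (- r * cos v, - r * sin v, 0).
Proof.
unfold d2 at 1; repeat f_equal; apply is_derive_unique;
  (eapply is_derive_ext; [intros s; rewrite d2_RX; reflexivity|]);
  unfold x1, x2, x3; simpl; auto_derive; auto; ring.
Qed.

Lemma cos2_sin2 (v : R) : sin v ^ 2 = 1 - cos v ^ 2.
Proof. generalize (sin2_cos2 v). unfold Rsqr. lra. Qed.

Lemma RX_minimal (e a : R) (z : R -> R) (r v : R) : profile e a z -> a < r ->
  mean_curvature (RX e z) r v = 0.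
Proof.
intros Hz ar. destruct (proj2 Hz r ar) as (r0 & w0 & dz).
unfold mean_curvature, unit_normal. cbv zeta.
rewrite d22_RX, d12_RX, (d11_RX e a), (d1_RX e a), d2_RX by auto.
(* The normalizing factor of the normal multiplies all three coefficients of the second form, so its
   value is irrelevant to the vanishing of the numerator. *)
set (k := / sqrt _). clearbody k.
(* A zero numerator suffices, also at degenerate points, where the denominator is zero. *)
match goal with |- ?n / ?d = 0 => assert (H : n = 0); [|rewrite H; apply Rmult_0_l] end.
unfold lor, cross, x1, x2, x3, scal, mult; simpl. unfold mult; simpl.
unfold prod_scal, scal; simpl; unfold mult; simpl.
generalize (cos2_sin2 v). intros s2.
destruct Hz as [e2 _].
set (c := cos v) in *; set (s := sin v) in *; clearbody c s.
set (w := / (r * (r * 1) + e)).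
assert (W : w * (r ^ 2 + e) = 1) by (unfold w; field; simpl in w0; lra).
replace (/ ((r * (r * 1) + e) * ((r * (r * 1) + e) * 1))) with (w ^ 2)
  by (unfold w; field; simpl in w0; lra).
clearbody w.
assert (e2' : e * e = 1) by lra.
assert (s2' : s * s = 1 - c * c) by lra.
(* The numerator is arranged so that [c^2 + s^2 = 1] and [w (r^2 + e) = 1] can be substituted in
   place; the last factor then collapses to [(1 - r^2 w)^2 - w^2]. *)
transitivity (k * w * r ^ 2 * (c ^ 2 + s * s) *
  (2 * r ^ 2 * w * (c * (w * (r ^ 2 + e)) - (c ^ 2 + s * s)) +
   (c ^ 2 + s * s - 2 * r ^ 2 * w * c + r ^ 4 * w ^ 2 - w ^ 2)));
  [ring|].
assert (w2 : w ^ 2 = (1 - r ^ 2 * w) ^ 2).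
{ replace (w ^ 2) with (e * e * w ^ 2) by (rewrite e2'; ring).
  replace (1 - r ^ 2 * w) with (e * w) by lra. ring. }
rewrite s2', W.
replace (2 * r ^ 2 * w * _ + _) with ((1 - r ^ 2 * w) ^ 2 - w ^ 2) by ring.
rewrite <- w2; ring.
Qed.

(** * Causal character *)

Lemma lor_sym (u w : V3) : lor u w = lor w u.
Proof. unfold lor; ring. Qed.

Lemma lin_coord (a b : R) (u v : V3) :
  plus (scal a u) (scal b v) =
  (a * x1 u + b * x1 v, a * x2 u + b * x2 v, a * x3 u + b * x3 v).
Proof. destruct u as [[? ?] ?], v as [[? ?] ?]. reflexivity. Qed.

Lemma V3_eq (p q : V3) : x1 p = x1 q -> x2 p = x2 q -> x3 p = x3 q -> p = q.
Proof.
destruct p as [[? ?] ?], q as [[? ?] ?]; unfold x1, x2, x3; simpl; congruence.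
Qed.

Lemma lor_lin_l (a b : R) (u v w : V3) :
  lor (plus (scal a u) (scal b v)) w = a * lor u w + b * lor v w.
Proof. rewrite lin_coord; unfold lor, x1, x2, x3; simpl; ring. Qed.

Lemma lor_lin_r (a b : R) (u v w : V3) :
  lor w (plus (scal a u) (scal b v)) = a * lor w u + b * lor w v.
Proof. rewrite lor_sym, lor_lin_l, (lor_sym u), (lor_sym v). reflexivity. Qed.

Lemma span2_zero (u v : V3) (a b : R) :
  a = 0 -> b = 0 -> plus (scal a u) (scal b v) = (zero : V3).
Proof.
intros -> ->. rewrite lin_coord. change (zero : V3) with ((0, 0, 0) : V3).
apply V3_eq; unfold x1, x2, x3; simpl; ring.
Qed.

Lemma span2_l (u v : V3) : span2 u v u.
Proof.
exists 1, 0. rewrite lin_coord. apply V3_eq; unfold x1, x2, x3; simpl; ring.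
Qed.

Lemma span2_r (u v : V3) : span2 u v v.
Proof.
exists 0, 1. rewrite lin_coord. apply V3_eq; unfold x1, x2, x3; simpl; ring.
Qed.

Definition gram (u v : V3) : R := lor u u * lor v v - lor u v ^ 2.

(** A vector [a u + b v] of the radical solves a homogeneous linear system with determinant
    [gram u v]. Conversely [lor v v * u - lor u v * v] is orthogonal to [v] and has square
    [lor v v * gram u v]; the same vector is the negative direction in the timelike case. The role
    of [v] is played below by the tangent of a circle, whose square is positive. *)
Lemma degenerate_span2_iff (u v : V3) : independent2 u v -> 0 < lor v v ->
  degenerate_subspace (span2 u v) <-> gram u v = 0.
Proof.
unfold gram; intros ind G0; split.
- intros (w & (a & b & ->) & w0 & H).
  assert (H1 := H u (span2_l u v)). assert (H2 := H v (span2_r u v)).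
  rewrite lor_lin_l in H1, H2. rewrite (lor_sym v u) in H1.
  destruct (Req_dec a 0) as [a0|a0].
  + destruct (Req_dec b 0) as [b0|b0]; [now destruct w0; apply span2_zero|].
    subst a. apply (Rmult_eq_reg_l b); [|exact b0]. nra.
  + apply (Rmult_eq_reg_l a); [|exact a0].
    replace (a * (lor u u * lor v v - lor u v ^ 2)) with
      ((a * lor u u + b * lor u v) * lor v v -
       (a * lor u v + b * lor v v) * lor u v) by ring.
    rewrite H1, H2. ring.
- intros g0. exists (plus (scal (lor v v) u) (scal (- lor u v) v)).
  split; [now exists (lor v v), (- lor u v)|split].
  + intros H. destruct (ind _ _ H). lra.
  + intros w' (a & b & ->). rewrite lor_lin_l, !lor_lin_r, (lor_sym v u).
    transitivity (a * (lor u u * lor v v - lor u v ^ 2)); [ring|].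
    rewrite g0; ring.
Qed.

(** Completing the square: for [w = a u + b v], [lor v v * lor w w] equals [(a * lor u v + b * lor v
    v)^2 + a^2 * gram u v]. *)
Lemma spacelike_span2 (u v : V3) : 0 < lor v v -> 0 < gram u v ->
  spacelike_subspace (span2 u v).
Proof.
unfold gram; intros G0 g0 w (a & b & ->) w0.
rewrite lor_lin_l, !lor_lin_r, (lor_sym v u).
apply (Rmult_lt_reg_l (lor v v)); [exact G0|].
rewrite Rmult_0_r.
match goal with |- 0 < ?x => replace x with
  ((a * lor u v + b * lor v v) ^ 2 + a ^ 2 * (lor u u * lor v v - lor u v ^ 2))
  by ring end.
destruct (Req_dec a 0) as [->|a0].
- destruct (Req_dec b 0) as [->|b0]; [now destruct w0; apply span2_zero|].
  assert (0 < (0 * lor u v + b * lor v v) ^ 2); [|nra].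
  apply pow2_gt_0. nra.
- assert (0 < a ^ 2) by now apply pow2_gt_0.
  assert (0 <= (a * lor u v + b * lor v v) ^ 2) by apply pow2_ge_0. nra.
Qed.

Lemma timelike_span2 (u v : V3) : independent2 u v -> 0 < lor v v ->
  gram u v < 0 -> timelike_subspace (span2 u v).
Proof.
intros ind G0 g0; split; [|split].
- rewrite degenerate_span2_iff by assumption. lra.
- exists (plus (scal (lor v v) u) (scal (- lor u v) v)).
  split; [now exists (lor v v), (- lor u v)|].
  rewrite lor_lin_l, !lor_lin_r, (lor_sym v u).
  match goal with |- ?x < 0 =>
    replace x with (lor v v * gram u v) by (unfold gram; ring) end. nra.
- exists v. split; [apply span2_r|exact G0].
Qed.

(** Only the radial derivative has a vertical component, and it is nonzero; this kills its
    coefficient, and the other vector is tangent to a circle of positive radius. *)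
Lemma RX_immersed (e a : R) (z : R -> R) (r v : R) : profile e a z -> a < r ->
  immersed_at (RX e z) r v.
Proof.
intros Hz ar. destruct (proj2 Hz r ar) as (r0 & w0 & dz).
unfold immersed_at, independent2. rewrite (d1_RX e a), d2_RX by auto.
assert (w1 : / (r ^ 2 + e) <> 0) by (apply Rinv_neq_0_compat; lra).
revert w1; generalize (/ (r ^ 2 + e)); intros w w1.
intros A B H. rewrite lin_coord in H.
assert (H1 := f_equal x1 H). assert (H2 := f_equal x2 H).
assert (H3 := f_equal x3 H). clear H.
change (x1 (zero : V3)) with 0 in H1. change (x2 (zero : V3)) with 0 in H2.
change (x3 (zero : V3)) with 0 in H3.
unfold x1, x2, x3 in H1, H2, H3; cbn [fst snd] in *.
assert (A0 : A = 0).
{ apply (Rmult_eq_reg_r w); [lra|exact w1]. }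
subst A. split; [reflexivity|].
generalize (cos2_sin2 v); intros s2.
assert (B * r = 0); [|nra].
assert (B * r * sin v = 0) by lra. assert (B * r * cos v = 0) by lra.
assert ((B * r) ^ 2 = 0); [|nra].
replace ((B * r) ^ 2) with ((B * r * sin v) ^ 2 + (B * r * cos v) ^ 2);
  [rewrite H, H0; ring|].
replace ((B * r * sin v) ^ 2) with ((B * r) ^ 2 * sin v ^ 2) by ring.
rewrite s2; ring.
Qed.

Lemma lor_d2_RX (e : R) (z : R -> R) (r v : R) :
  lor (d2 (RX e z) r v) (d2 (RX e z) r v) = r ^ 2.
Proof.
rewrite d2_RX. unfold lor, x1, x2, x3; simpl.
generalize (cos2_sin2 v). nra.
Qed.

Lemma gram_RX (e a : R) (z : R -> R) (r v : R) : profile e a z -> a < r ->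
  gram (d1 (RX e z) r v) (d2 (RX e z) r v) =
  r ^ 4 * / (r ^ 2 + e) ^ 2 * (1 - cos v) * (r ^ 2 * (1 - cos v) + 2 * e).
Proof.
intros Hz ar. destruct (proj2 Hz r ar) as (r0 & w0 & dz).
unfold gram. rewrite lor_d2_RX.
rewrite (d1_RX e a), d2_RX by auto.
generalize (cos2_sin2 v); intros s2.
unfold lor, x1, x2, x3; cbn [fst snd].
replace (/ (r ^ 2 + e) ^ 2) with ((/ (r ^ 2 + e)) ^ 2) by (field; lra).
assert (W : / (r ^ 2 + e) * (r ^ 2 + e) = 1) by (field; lra).
set (w := / (r ^ 2 + e)) in *. clearbody w.
assert (e2 := proj1 Hz).
set (c := cos v) in *; set (s := sin v) in *; clearbody c s.
transitivity (r ^ 2 *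
  (c ^ 2 + s ^ 2 - 2 * r ^ 2 * w * c + r ^ 4 * w ^ 2 - w ^ 2) - r ^ 6 * w ^ 2 * s ^ 2);
  [ring|].
assert (ew : e * w = 1 - r ^ 2 * w) by lra.
(* The determinant is [r^2 ((1 - r^2 w c)^2 - w^2)]. Writing [1 - r^2 w c] as [e w + r^2 w (1 - c)]
   lets the difference of squares split off the factor [1 - c]. *)
transitivity (r ^ 2 * ((e * w + r ^ 2 * w * (1 - c)) ^ 2 - e ^ 2 * w ^ 2)); [|ring].
rewrite s2, ew, e2. ring.
Qed.

(** * Smoothness *)

(** A class of functions closed under differentiation, so that smoothness of every order becomes an
    induction. The last constructor takes in primitives, since the heights are given only by their
    rational derivative. *)
Inductive smooth_ray (a : R) : (R -> R) -> Prop :=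
| smooth_ray_const c : smooth_ray a (fun _ => c)
| smooth_ray_id : smooth_ray a (fun r => r)
| smooth_ray_plus f g :
    smooth_ray a f -> smooth_ray a g -> smooth_ray a (fun r => f r + g r)
| smooth_ray_mult f g :
    smooth_ray a f -> smooth_ray a g -> smooth_ray a (fun r => f r * g r)
| smooth_ray_inv f :
    (forall r, a < r -> f r <> 0) -> smooth_ray a f ->
    smooth_ray a (fun r => / f r)
| smooth_ray_primitive f g :
    (forall r, a < r -> is_derive f r (g r)) -> smooth_ray a g ->
    smooth_ray a f.

Lemma smooth_ray_derive (a : R) (f : R -> R) : smooth_ray a f ->
  exists g, smooth_ray a g /\ forall r, a < r -> is_derive f r (g r).
Proof.
induction 1 as [c| |f g _ (f' & Sf & Df) _ (g' & Sg & Dg)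
  |f g Hf (f' & Sf & Df) Hg (g' & Sg & Dg)|f f0 Hf (f' & Sf & Df)|f g Df Hg _].
- exists (fun _ => 0). split; [constructor|]. intros; auto_derive; auto.
- exists (fun _ => 1). split; [constructor|]. intros; auto_derive; auto.
- exists (fun r => f' r + g' r). split; [now constructor|].
  intros r ar. apply (is_derive_plus f g); auto.
- exists (fun r => f' r * g r + f r * g' r).
  split; [now repeat constructor|].
  intros r ar. apply (is_derive_mult f g); auto. apply Rmult_comm.
- exists (fun r => (-1) * (f' r * (/ f r * / f r))).
  split; [now repeat constructor|].
  intros r ar. replace (-1 * _) with (- f' r / f r ^ 2) by (field; auto).
  apply is_derive_inv; auto.
- exists g; auto.
Qed.

Lemma locally_ray (a r : R) : a < r -> locally r (fun s => a < s).
Proof.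
intros ar. assert (d : 0 < r - a) by lra. exists (mkposreal _ d). intros s Hs.
apply Rabs_lt_between' in Hs. simpl in Hs. lra.
Qed.

Lemma smooth_ray_continuity (a : R) (f : R -> R) (r : R) :
  smooth_ray a f -> a < r -> continuity_pt f r.
Proof.
intros Sf ar. destruct (smooth_ray_derive a f Sf) as (g & _ & Dg).
apply continuity_pt_filterlim.
apply (ex_derive_continuous (V := R_NormedModule)). exists (g r); auto.
Qed.

(** The shape [A u + B u (al cos v + be sin v)] is stable under both partial derivatives: the first
    differentiates [A] and [B], the second drops [A] and turns [(al, be)] into [(be, - al)].
    Equality with [f] is required on the ray only, because the partial derivatives are known only
    there. *)
Lemma Ck_trig (a : R) (D : R -> R -> Prop) : (forall u v, D u v -> a < u) ->
  forall (k : nat) (A B : R -> R) (al be : R) (f : R -> R -> R),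
  smooth_ray a A -> smooth_ray a B ->
  (forall u v, a < u -> f u v = A u + B u * (al * cos v + be * sin v)) ->
  Ck k D f.
Proof.
intros HD. induction k as [|k IH]; intros A B al be f SA SB Hf.
all: assert (Cf : forall u v, D u v -> continuity_2d_pt f u v).
1, 3: intros u v Duv; assert (au := HD u v Duv);
  apply continuity_2d_pt_ext_loc with
    (f := fun u v => A u + B u * (al * cos v + be * sin v));
  [destruct (locally_ray a u au) as [d Hd]; exists d; intros u' v' Hu _;
   symmetry; apply Hf, Hd, Hu|];
  apply continuity_2d_pt_plus; [|apply continuity_2d_pt_mult];
  [apply (continuity_1d_2d_pt_comp A (fun u _ => u));
     [now apply smooth_ray_continuity with a|apply continuity_2d_pt_id1]
  |apply (continuity_1d_2d_pt_comp B (fun u _ => u));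
     [now apply smooth_ray_continuity with a|apply continuity_2d_pt_id1]
  |apply (continuity_1d_2d_pt_comp (fun v => al * cos v + be * sin v)
     (fun _ v => v)); [reg|apply continuity_2d_pt_id2]].
- now split.
- destruct (smooth_ray_derive a A SA) as (A' & SA' & DA).
  destruct (smooth_ray_derive a B SB) as (B' & SB' & DB).
  assert (D1 : forall u v, a < u -> is_derive (fun s => f s v) u
    (A' u + B' u * (al * cos v + be * sin v))).
  { intros u v au.
    apply is_derive_ext_loc with
      (fun s => A s + B s * (al * cos v + be * sin v)).
    - destruct (locally_ray a u au) as [d Hd]; exists d; intros s Hs.
      symmetry; apply Hf, Hd, Hs.
    - auto_derive.
      + split; [exists (A' u); auto|split; [exists (B' u); auto|auto]].
      + replace (Derive (fun x => A x) u) with (A' u)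
          by (symmetry; apply is_derive_unique; auto).
        replace (Derive (fun x => B x) u) with (B' u)
          by (symmetry; apply is_derive_unique; auto).
        ring. }
  assert (D2 : forall u v, a < u -> is_derive (fun s => f u s) v
    (0 + B u * (be * cos v + (- al) * sin v))).
  { intros u v au.
    apply is_derive_ext with
      (fun s => A u + B u * (al * cos s + be * sin s)).
    - intros s; symmetry; auto.
    - auto_derive; [auto|ring]. }
  split; [exact Cf|split; [|split]].
  + intros u v Duv; split; eexists; [apply D1|apply D2]; eauto.
  + apply (IH A' B' al be); auto.
    intros u v au. apply is_derive_unique; auto.
  + apply (IH (fun _ => 0) B be (- al)); auto; [constructor|].
    intros u v au. apply is_derive_unique; auto.
Qed.

Lemma RX_smooth (e a : R) (z : R -> R) (D : R -> R -> Prop) :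
  profile e a z -> (forall r v, D r v -> a < r) -> smooth_map (RX e z) D.
Proof.
intros [_ Hz] HD k.
assert (Sz : smooth_ray a z).
{ apply smooth_ray_primitive with (fun r => / (r * r + e)).
  - intros r ar. replace (r * r) with (r ^ 2) by ring. now apply Hz.
  - apply smooth_ray_inv; [|now repeat constructor].
    intros r ar. replace (r * r) with (r ^ 2) by ring.
    destruct (Hz r ar). lra. }
unfold RX, x1, x2, x3; cbn [fst snd].
split; [|split].
- apply (Ck_trig a D HD k (fun r => e * z r + (-1) * r) (fun r => r) 1 0);
    [repeat constructor; auto|constructor|]. intros; ring.
- apply (Ck_trig a D HD k (fun _ => 0) (fun r => r) 0 1);
    [constructor|constructor|]. intros; ring.
- apply (Ck_trig a D HD k z (fun _ => 0) 0 0); [auto|constructor|].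
  intros; ring.
Qed.

(** * Absence of rotational symmetry *)

Lemma increasing_ray (a : R) (f g : R -> R) :
  (forall r, a < r -> is_derive f r (g r)) -> (forall r, a < r -> 0 < g r) ->
  forall r s, a < r -> r < s -> f r < f s.
Proof.
intros Df g0 r s ar rs.
apply (incr_function f a p_infty g); simpl; auto.
intros x ax _. now apply g0.
Qed.

Lemma polar_angle (c s : R) : c ^ 2 + s ^ 2 = 1 ->
  exists v, 0 <= v < 2 * PI /\ cos v = c /\ sin v = s.
Proof.
intros cs. assert (c1 : -1 <= c <= 1) by nra.
destruct (acos_bound c) as [A0 A1]. assert (P := PI_RGT_0).
destruct (Rle_lt_dec 0 s) as [s0|s0].
- exists (acos c). split; [lra|]. rewrite cos_acos, sin_acos by lra.
  split; [reflexivity|]. apply sqrt_lem_1; unfold Rsqr; nra.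
- exists (2 * PI - acos c).
  assert (A2 : acos c <> 0).
  { intros A2. assert (H := cos_acos c c1). rewrite A2, cos_0 in H. nra. }
  split; [lra|].
  rewrite cos_minus, sin_minus, cos_2PI, sin_2PI, cos_acos, sin_acos by lra.
  split; [ring|].
  enough (sqrt (1 - Rsqr c) = - s) by lra.
  apply sqrt_lem_1; unfold Rsqr; nra.
Qed.

Lemma minus_coord (p q : V3) : minus p q = (x1 p - x1 q, x2 p - x2 q, x3 p - x3 q).
Proof. destruct p as [[? ?] ?], q as [[? ?] ?]. reflexivity. Qed.

Lemma lor_minus_minus (p q p' q' : V3) : lor (minus p q) (minus p' q') =
  (x1 p - x1 q) * (x1 p' - x1 q') + (x2 p - x2 q) * (x2 p' - x2 q') -
  (x3 p - x3 q) * (x3 p' - x3 q').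
Proof. rewrite !minus_coord. reflexivity. Qed.

(* Polarizing the hypothesis with the basis vectors expresses the coordinates
   of [K p - K 0] through the values of [K] at the basis. *)
Lemma killing_field_affine (K : V3 -> V3) :
  (forall p q, lor (minus (K p) (K q)) (minus p q) = 0) ->
  exists al be ga b1 b2 b3 : R, forall p,
    x1 (K p) = - al * x2 p + be * x3 p + b1 /\
    x2 (K p) = al * x1 p + ga * x3 p + b2 /\
    x3 (K p) = be * x1 p + ga * x2 p + b3.
Proof.
intros H.
pose (o := (0, 0, 0) : V3). pose (i := (1, 0, 0) : V3).
pose (j := (0, 1, 0) : V3). pose (k := (0, 0, 1) : V3).
exists (x2 (K i) - x2 (K o)), (x3 (K i) - x3 (K o)), (x3 (K j) - x3 (K o)),
  (x1 (K o)), (x2 (K o)), (x3 (K o)).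
intros p.
assert (Hio := H i o). assert (Hjo := H j o). assert (Hko := H k o).
assert (Hij := H i j). assert (Hik := H i k). assert (Hjk := H j k).
assert (Hpo := H p o). assert (Hpi := H p i). assert (Hpj := H p j).
assert (Hpk := H p k).
rewrite lor_minus_minus in *.
unfold o, i, j, k in *; unfold x1, x2, x3 in *; cbn [fst snd] in *.
destruct p as [[p1 p2] p3]; cbn [fst snd] in *.
repeat split; nra.
Qed.

Lemma is_derive_coord (f : R -> V3) (t : R) (l : V3) : is_derive f t l ->
  is_derive (fun s => x1 (f s)) t (x1 l) /\
  is_derive (fun s => x2 (f s)) t (x2 l) /\
  is_derive (fun s => x3 (f s)) t (x3 l).
Proof.
intros Df.
assert (D12 : is_derive (fun s => fst (f s)) t (fst l)).
{ apply (filterdiff_comp f fst _ fst Df).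
  apply filterdiff_linear, is_linear_fst. }
split; [|split].
- apply (filterdiff_comp (fun s => fst (f s)) fst _ fst D12).
  apply filterdiff_linear, is_linear_fst.
- apply (filterdiff_comp (fun s => fst (f s)) snd _ snd D12).
  apply filterdiff_linear, is_linear_snd.
- apply (filterdiff_comp f snd _ snd Df).
  apply filterdiff_linear, is_linear_snd.
Qed.

Definition generator (rho : R -> V3 -> V3) (p : V3) : V3 :=
  (Derive (fun s => x1 (rho s p)) 0, Derive (fun s => x2 (rho s p)) 0,
   Derive (fun s => x3 (rho s p)) 0).

(** By the group law, the orbit of [p] near time [t] is the orbit of [rho t p] near time 0; orbits
    are thus integral curves of the generator. *)
Lemma generator_derive (rho : R -> V3 -> V3) (p : V3) (t : R) :
  rotation_group rho ->
  is_derive (fun s => x1 (rho s p)) t (x1 (generator rho (rho t p))) /\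
  is_derive (fun s => x2 (rho s p)) t (x2 (generator rho (rho t p))) /\
  is_derive (fun s => x3 (rho s p)) t (x3 (generator rho (rho t p))).
Proof.
intros (_ & Hadd & _ & Hd & _).
assert (D0 : forall q,
  is_derive (fun s => x1 (rho s q)) 0 (x1 (generator rho q)) /\
  is_derive (fun s => x2 (rho s q)) 0 (x2 (generator rho q)) /\
  is_derive (fun s => x3 (rho s q)) 0 (x3 (generator rho q))).
{ intros q. destruct (Hd q 0) as [l Hl].
  destruct (is_derive_coord _ _ _ Hl) as (L1 & L2 & L3).
  unfold generator, x1 at 2, x2 at 2, x3 at 2; cbn [fst snd].
  split; [|split]; apply Derive_correct; eexists; eassumption. }
assert (shift : forall (x : V3 -> R) (l : R),
  is_derive (fun s => x (rho s (rho t p))) 0 l ->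
  is_derive (fun s => x (rho s p)) t l).
{ intros x l Hl.
  apply is_derive_ext with (fun s => x (rho (s - t) (rho t p))).
  - intros s. rewrite <- Hadd. do 2 f_equal. ring.
  - replace l with (1 * l) by ring.
    apply (is_derive_comp (fun s => x (rho s (rho t p))) (fun s => s - t)).
    + replace (t - t) with 0 by ring. exact Hl.
    + auto_derive; auto; ring. }
destruct (D0 (rho t p)) as (H1 & H2 & H3). auto.
Qed.

Lemma is_derive_locally_const (f : R -> R) (t l C : R) :
  is_derive f t l -> locally t (fun s => f s = C) -> l = 0.
Proof.
intros Df Hf. rewrite <- (is_derive_unique _ _ _ Df).
rewrite (Derive_ext_loc f (fun _ => C) t Hf). apply Derive_const.
Qed.

Lemma is_derive_lorentz_square (f1 f2 f3 g1 g2 g3 : R -> R)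
    (t a1 a2 a3 b1 b2 b3 : R) :
  is_derive f1 t a1 -> is_derive f2 t a2 -> is_derive f3 t a3 ->
  is_derive g1 t b1 -> is_derive g2 t b2 -> is_derive g3 t b3 ->
  is_derive (fun s => (f1 s - g1 s) * (f1 s - g1 s) +
    (f2 s - g2 s) * (f2 s - g2 s) - (f3 s - g3 s) * (f3 s - g3 s)) t
    (2 * ((a1 - b1) * (f1 t - g1 t) + (a2 - b2) * (f2 t - g2 t) -
       (a3 - b3) * (f3 t - g3 t))).
Proof.
intros P1 P2 P3 Q1 Q2 Q3.
auto_derive; [repeat split; eexists; eassumption|].
replace (Derive (fun x => f1 x) t) with a1
  by (symmetry; now apply is_derive_unique).
replace (Derive (fun x => f2 x) t) with a2
  by (symmetry; now apply is_derive_unique).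
replace (Derive (fun x => f3 x) t) with a3
  by (symmetry; now apply is_derive_unique).
replace (Derive (fun x => g1 x) t) with b1
  by (symmetry; now apply is_derive_unique).
replace (Derive (fun x => g2 x) t) with b2
  by (symmetry; now apply is_derive_unique).
replace (Derive (fun x => g3 x) t) with b3
  by (symmetry; now apply is_derive_unique).
ring.
Qed.

(** The squared Lorentzian length of [rho s p - rho s q] is constant in [s]; its derivative at 0 is
    twice the stated product. *)
Lemma generator_killing (rho : R -> V3 -> V3) : rotation_group rho ->
  forall p q, lor (minus (generator rho p) (generator rho q)) (minus p q) = 0.
Proof.
intros Hrho p q.
destruct (generator_derive rho p 0 Hrho) as (P1 & P2 & P3).
destruct (generator_derive rho q 0 Hrho) as (Q1 & Q2 & Q3).
destruct Hrho as (H0 & _ & Hiso & _).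
rewrite !H0 in *.
assert (D := is_derive_lorentz_square _ _ _ _ _ _ _ _ _ _ _ _ _ P1 P2 P3 Q1 Q2 Q3).
cbv beta in D. rewrite !H0, <- lor_minus_minus in D.
enough (2 * lor (minus (generator rho p) (generator rho q)) (minus p q) = 0)
  by lra.
apply (is_derive_locally_const _ _ _ (lor (minus p q) (minus p q)) D).
exists (mkposreal 1 Rlt_0_1). intros s _.
rewrite <- (Hiso s p q), lor_minus_minus. reflexivity.
Qed.

Lemma derive_0_const (f : R -> R) : (forall t, is_derive f t 0) ->
  forall s t, f s = f t.
Proof.
intros Df s t.
destruct (MVT_gen f s t (fun _ => 0)) as (c & _ & H); [now auto| |lra].
intros x _. apply continuity_pt_filterlim.
apply (ex_derive_continuous (V := R_NormedModule)). exists 0; auto.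
Qed.

(** A vanishing generator would make every orbit constant, against the nontriviality clause of
    [rotation_group]. *)
Lemma generator_neq_0 (rho : R -> V3 -> V3) : rotation_group rho ->
  ~ (forall p, generator rho p = (0, 0, 0)).
Proof.
intros Hrho HK. assert (H := fun p t => generator_derive rho p t Hrho).
destruct Hrho as (H0 & _ & _ & _ & _ & t & p & Hp). apply Hp.
rewrite <- (H0 p) at 2.
apply V3_eq;
  [apply (derive_0_const (fun s => x1 (rho s p)))
  |apply (derive_0_const (fun s => x2 (rho s p)))
  |apply (derive_0_const (fun s => x3 (rho s p)))];
  intros s; destruct (H p s) as (K1 & K2 & K3); rewrite HK in K1, K2, K3;
  assumption.
Qed.

(* Differentiates the equation of the leaves along a curve [(f1, f2, f3)]. *)
Lemma is_derive_leaf_equation (e : R) (f1 f2 f3 Rd : R -> R)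
    (t a1 a2 a3 l : R) :
  is_derive f1 t a1 -> is_derive f2 t a2 -> is_derive f3 t a3 ->
  is_derive Rd (f3 t) l ->
  is_derive (fun s => (f1 s - e * f3 s) ^ 2 +
    2 * (f1 s - e * f3 s) * Rd (f3 s) + f2 s ^ 2) t
    (2 * ((f1 t - e * f3 t + Rd (f3 t)) * (a1 - e * a3) +
       (f1 t - e * f3 t) * l * a3 + f2 t * a2)).
Proof.
intros P1 P2 P3 Q.
auto_derive; [repeat split; eexists; eassumption|].
replace (Derive (fun x => f1 x) t) with a1
  by (symmetry; now apply is_derive_unique).
replace (Derive (fun x => f2 x) t) with a2
  by (symmetry; now apply is_derive_unique).
replace (Derive (fun x => f3 x) t) with a3
  by (symmetry; now apply is_derive_unique).
replace (Derive (fun x => Rd x) (f3 t)) with l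
  by (symmetry; now apply is_derive_unique).
ring.
Qed.

(** The orbit stays on the surface for small times and so keeps satisfying the leaf equation. The
    derivative of that equation at time 0 is [2 * r] times the left-hand side. *)
Lemma tangency_equation (e a : R) (z Rd : R -> R) (D : R -> R -> Prop)
    (rho : R -> V3 -> V3) (r v : R) :
  profile e a z -> (forall u w, D u w -> a < u) ->
  (forall u, a < u -> Rd (z u) = u /\ is_derive Rd (z u) (u ^ 2 + e)) ->
  rotation_group rho -> a < r ->
  (exists eps, 0 < eps /\ forall t, Rabs t < eps ->
     image (RX e z) D (rho t (RX e z r v))) ->
  let K := generator rho (RX e z r v) in
  cos v * (x1 K - e * x3 K) + (cos v - 1) * (r ^ 2 + e) * x3 K +
    sin v * x2 K = 0.
Proof.
intros Hz HD HR Hrho ar (eps & eps0 & Him) K.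
destruct (proj2 Hz r ar) as (r0 & _ & _).
destruct (generator_derive rho (RX e z r v) 0 Hrho) as (P1 & P2 & P3).
assert (H0 := proj1 Hrho). rewrite H0 in P1, P2, P3.
fold K in P1, P2, P3.
destruct (HR r ar) as [HRr DR].
assert (D0 := fun Q => is_derive_leaf_equation e _ _ _ Rd _ _ _ _ (r ^ 2 + e)
  P1 P2 P3 Q).
cbv beta in D0. rewrite !H0 in D0.
change (x1 (RX e z r v)) with (e * z r - r + r * cos v) in D0.
change (x2 (RX e z r v)) with (r * sin v) in D0.
change (x3 (RX e z r v)) with (z r) in D0.
specialize (D0 DR). rewrite HRr in D0.
apply (Rmult_eq_reg_l (2 * r)); [|lra]. rewrite Rmult_0_r.
etransitivity; [|apply (is_derive_locally_const _ _ _ 0 D0)]; [ring|].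
exists (mkposreal eps eps0). intros s Hs.
change (Rabs (s - 0) < eps) in Hs. rewrite Rminus_0_r in Hs.
destruct (Him s Hs) as (r' & v' & HD' & E).
rewrite E.
change (x1 (RX e z r' v')) with (e * z r' - r' + r' * cos v').
change (x2 (RX e z r' v')) with (r' * sin v').
change (x3 (RX e z r' v')) with (z r').
rewrite (proj1 (HR r' (HD _ _ HD'))).
generalize (cos2_sin2 v'). nra.
Qed.

(** On the circle [s^2] is [1 - c^2], so these five monomials span the quadratic polynomials. Five
    rational points with [c <= 0], two of them from the triple 3, 4, 5, determine the
    coefficients. *)
Lemma half_circle_quadratic_0 (a0 a1 a2 a3 a4 : R) :
  (forall c s, c ^ 2 + s ^ 2 = 1 -> c <= 0 ->
     a0 + a1 * c + a2 * s + a3 * c ^ 2 + a4 * (c * s) = 0) ->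
  a0 = 0 /\ a1 = 0 /\ a2 = 0 /\ a3 = 0 /\ a4 = 0.
Proof.
intros T.
assert (T1 := T (-1) 0 ltac:(lra) ltac:(lra)).
assert (T2 := T 0 1 ltac:(lra) ltac:(lra)).
assert (T3 := T 0 (-1) ltac:(lra) ltac:(lra)).
assert (T4 := T (-3/5) (4/5) ltac:(lra) ltac:(lra)).
assert (T5 := T (-3/5) (-4/5) ltac:(lra) ltac:(lra)).
repeat split; lra.
Qed.

Lemma RX_not_rotational (e a : R) (z Rd : R -> R) (D : R -> R -> Prop)
    (r1 r2 : R) :
  profile e a z -> (forall u v, D u v -> a < u) ->
  (forall u, a < u -> Rd (z u) = u /\ is_derive Rd (z u) (u ^ 2 + e)) ->
  a < r1 < r2 ->
  (forall r v, r = r1 \/ r = r2 -> 0 < v < 2 * PI -> cos v <= 0 ->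
     locally ((r, v) : R * R) (fun w : R * R => D (fst w) (snd w))) ->
  ~ rotational (RX e z) D.
Proof.
intros Hz HD HR Hr Hint (rho & Hrho & Hinv).
apply (generator_neq_0 rho Hrho).
destruct (killing_field_affine _ (generator_killing rho Hrho))
  as (al & be & ga & b1 & b2 & b3 & HK).
assert (main : forall r, r = r1 \/ r = r2 ->
  be = 0 /\ ga = 0 /\ b1 = 0 /\ b3 = 0 /\ al * (e * z r - r) + b2 = 0).
{ intros r Hr'. assert (ar : a < r) by (destruct Hr'; lra).
  destruct (proj2 Hz r ar) as (r0 & w0 & _).
  assert (T : forall c s, c ^ 2 + s ^ 2 = 1 -> c <= 0 ->
    c * (- al * (r * s) + be * z r + b1 -
         e * (be * (e * z r - r + r * c) + ga * (r * s) + b3)) +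
    (c - 1) * (r ^ 2 + e) * (be * (e * z r - r + r * c) + ga * (r * s) + b3) +
    s * (al * (e * z r - r + r * c) + ga * z r + b2) = 0).
  { intros c s cs c0. destruct (polar_angle c s cs) as (v & Hv & <- & <-).
    assert (v0 : v <> 0) by (intros ->; rewrite cos_0 in c0; lra).
    assert (E := tangency_equation e a z Rd D rho r v Hz HD HR Hrho ar).
    cbv zeta in E. destruct (HK (RX e z r v)) as (K1 & K2 & K3).
    rewrite K1, K2, K3 in E. apply E, Hinv, Hint; auto. lra. }
  set (d := e * z r - r) in *.
  destruct (half_circle_quadratic_0 (- (r ^ 2 + e) * (be * d + b3))
    (be * z r + b1 + r ^ 2 * (be * d + b3) - (r ^ 2 + e) * be * r)
    (al * d + ga * z r + b2 - (r ^ 2 + e) * ga * r)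
    (r ^ 3 * be) (r ^ 3 * ga)) as (A0 & A1 & A2 & A3 & A4).
  { intros c s cs c0. rewrite <- (T c s cs c0). ring. }
  assert (r3 : r ^ 3 <> 0) by (apply pow_nonzero; lra).
  assert (be = 0) by (apply (Rmult_eq_reg_l (r ^ 3)); [lra|exact r3]).
  assert (ga = 0) by (apply (Rmult_eq_reg_l (r ^ 3)); [lra|exact r3]).
  subst be ga.
  assert (b3 = 0) by (apply (Rmult_eq_reg_l (- (r ^ 2 + e))); lra).
  subst b3. repeat split; lra. }
destruct (main r1 (or_introl eq_refl)) as (-> & -> & -> & -> & E1).
destruct (main r2 (or_intror eq_refl)) as (_ & _ & _ & _ & E2).
(* What survives on a leaf is a rotation about the vertical axis through its own centre, at
   [x1 = e z - r]. The centres of the two leaves differ because [r - e z] is strictly increasing. *)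
assert (dd : r1 - e * z r1 < r2 - e * z r2).
{ apply (increasing_ray a (fun r => r - e * z r) (fun r => r ^ 2 * / (r ^ 2 + e))).
  - intros r ar. destruct (proj2 Hz r ar) as (r0 & w0 & dz).
    auto_derive; [exists (/ (r ^ 2 + e)); exact dz|].
    replace (Derive (fun x => z x) r) with (/ (r ^ 2 + e))
      by (symmetry; now apply is_derive_unique).
    simpl in w0; field. lra.
  - intros r ar. destruct (proj2 Hz r ar) as (r0 & w0 & dz).
    apply Rmult_lt_0_compat; [nra|now apply Rinv_0_lt_compat].
  - lra.
  - lra. }
assert (al = 0) by nra. subst al.
assert (b2 = 0) by lra. subst b2.
intros p. destruct (HK p) as (K1 & K2 & K3).
apply V3_eq; [rewrite K1|rewrite K2|rewrite K3];
  unfold x1, x2, x3; cbn [fst snd]; ring.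
Qed.

(** * Leaves and their limits *)

(* The leaf of radius [r], restricted to [cos v < k r]; the constant [k = 2]
   imposes no restriction and [k = 1] punctures the circle. *)
Definition arc (e : R) (z k : R -> R) (r : R) : V3 -> Prop :=
  fun p => exists c s, c ^ 2 + s ^ 2 = 1 /\ c < k r /\
    p = (e * z r - r + r * c, r * s, z r).

(** Stated through the pair [(cos v, sin v)] because the domains treat angles differently:
    [dom_plus] confines [v] to one period, whereas [dom_minus] and [dom_minus_full] are periodic in
    [v]. *)
Definition cut_by (D : R -> R -> Prop) (I : R -> Prop) (k : R -> R) : Prop :=
  forall r c s, c ^ 2 + s ^ 2 = 1 ->
    ((exists v, D r v /\ cos v = c /\ sin v = s) <-> I r /\ c < k r).

Lemma cos2_plus_sin2 (v : R) : cos v ^ 2 + sin v ^ 2 = 1.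
Proof. rewrite cos2_sin2; ring. Qed.

Lemma slice_arc (e : R) (z : R -> R) (D : R -> R -> Prop) (I : R -> Prop)
    (k : R -> R) (r : R) (p : V3) : cut_by D I k ->
  ((exists v, D r v /\ p = RX e z r v) <-> I r /\ arc e z k r p).
Proof.
intros HD. split.
- intros (v & Dv & ->). destruct (HD r (cos v) (sin v) (cos2_plus_sin2 v)) as [H _].
  destruct H as [Ir H]; [now exists v|].
  split; [exact Ir|]. exists (cos v), (sin v).
  split; [apply cos2_plus_sin2|now split].
- intros (Ir & c & s & cs & ck & ->).
  destruct (proj2 (HD r c s cs) (conj Ir ck)) as (v & Dv & <- & <-).
  now exists v.
Qed.

Lemma z_increasing (e a : R) (z : R -> R) (r s : R) : profile e a z ->
  a < r -> r < s -> z r < z s.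
Proof.
intros [_ Hz]. apply (increasing_ray a z (fun r => / (r ^ 2 + e))).
- intros t at0. now apply Hz.
- intros t at0. now apply Rinv_0_lt_compat, Hz.
Qed.

Lemma z_injective (e a : R) (z : R -> R) (r s : R) : profile e a z ->
  a < r -> a < s -> z r = z s -> r = s.
Proof.
intros Hz ar as0 E. destruct (Rtotal_order r s) as [H|[H|H]]; [|exact H|].
- generalize (z_increasing e a z r s Hz ar H); lra.
- generalize (z_increasing e a z s r Hz as0 H); lra.
Qed.

(** The height is injective on the ray, so a horizontal section meets a single circle of the
    family. *)
Lemma leaf_arc (e a : R) (z : R -> R) (D : R -> R -> Prop) (I : R -> Prop)
    (k : R -> R) (r : R) (p : V3) :
  profile e a z -> cut_by D I k -> (forall u, I u -> a < u) -> I r ->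
  (leaf (image (RX e z) D) (z r) p <-> arc e z k r p).
Proof.
intros Hz HD HI Ir. split.
- intros [(u & v & Duv & ->) E]. change (z u = z r) in E.
  destruct (proj1 (slice_arc e z D I k u (RX e z u v) HD)) as [Iu Hu];
    [now exists v|].
  replace r with u; [exact Hu|]. apply (z_injective e a z); auto.
- intros Hp.
  destruct (proj2 (slice_arc e z D I k r p HD) (conj Ir Hp)) as (v & Dv & ->).
  split; [now exists r, v|reflexivity].
Qed.

Lemma image_height (e : R) (z : R -> R) (D : R -> R -> Prop) (I : R -> Prop)
    (k : R -> R) (p : V3) : cut_by D I k -> image (RX e z) D p ->
  exists r, I r /\ x3 p = z r.
Proof.
intros HD (u & v & Duv & ->). exists u. split; [|reflexivity].
apply (slice_arc e z D I k u (RX e z u v) HD). now exists v.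
Qed.

(** The cosine decreases on [[0, PI]] and is symmetric about [PI]. The value [k = 1] gives the
    interval [(0, 2 PI)]: a punctured circle is also an open arc. *)
Lemma arc_angle (k c s : R) : -1 < k <= 1 -> c ^ 2 + s ^ 2 = 1 ->
  (c < k <-> exists t, acos k < t < 2 * PI - acos k /\ cos t = c /\ sin t = s).
Proof.
intros Hk cs. destruct (acos_bound k) as [A0 A1]. assert (P := PI_RGT_0).
assert (Ck := cos_acos k ltac:(lra)).
assert (half : forall t, acos k < t <= PI -> cos t < k).
{ intros t Ht. rewrite <- Ck. apply cos_decreasing_1; lra. }
assert (half' : forall t, 0 <= t <= acos k -> k <= cos t).
{ intros t Ht. rewrite <- Ck. apply cos_decr_1; lra. }
assert (refl : forall t, cos (2 * PI - t) = cos t).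
{ intros t. rewrite cos_minus, cos_2PI, sin_2PI. ring. }
split.
- intros ck. destruct (polar_angle c s cs) as (t & Ht & <- & <-).
  exists t. split; [|now split].
  split; apply Rnot_le_lt; intros H.
  + generalize (half' t); lra.
  + generalize (half' (2 * PI - t)). rewrite refl. lra.
- intros (t & Ht & <- & _).
  destruct (Rle_lt_dec t PI) as [H|H]; [apply half; lra|].
  rewrite <- refl. apply half; lra.
Qed.

Lemma plus_scal_coord (t : R) (p u : V3) :
  plus p (scal t u) = (x1 p + t * x1 u, x2 p + t * x2 u, x3 p + t * x3 u).
Proof. destruct p as [[? ?] ?], u as [[? ?] ?]. reflexivity. Qed.

Lemma arc_is_hcircle_arc (e : R) (z k : R -> R) (r : R) (A : V3 -> Prop) :
  0 < r -> -1 < k r <= 1 -> (forall p, A p <-> arc e z k r p) ->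
  is_hcircle_arc A.
Proof.
intros r0 Hk HA. destruct (acos_bound (k r)) as [A0 A1].
assert (Ck := cos_acos (k r) ltac:(lra)).
exists (e * z r - r, 0, z r), r, (acos (k r)), (2 * PI - acos (k r)).
split; [exact r0|split].
- enough (acos (k r) <> PI) by lra.
  intros H. rewrite H, cos_PI in Ck. lra.
- intros p. rewrite HA. split.
  + intros (c & s & cs & ck & ->).
    destruct (proj1 (arc_angle (k r) c s Hk cs) ck) as (t & Ht & <- & <-).
    exists t. split; [exact Ht|].
    rewrite plus_scal_coord.
      apply V3_eq; unfold x1, x2, x3; cbn [fst snd]; ring.
  + intros (t & Ht & ->). exists (cos t), (sin t).
    split; [apply cos2_plus_sin2|split].
    * apply (arc_angle (k r) (cos t) (sin t) Hk (cos2_plus_sin2 t)).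
      now exists t.
    * rewrite plus_scal_coord.
      apply V3_eq; unfold x1, x2, x3; cbn [fst snd]; ring.
Qed.

Lemma arc_hcircle (e : R) (z k : R -> R) (r : R) (p : V3) : 0 < r ->
  (arc e z k r p <->
   hcircle (e * z r - r, 0, z r) r p /\ x1 p < e * z r - r + r * k r).
Proof.
intros r0. unfold hcircle. split.
- intros (c & s & cs & ck & ->). unfold x1, x2, x3; cbn [fst snd].
  repeat split; [|nra].
  replace ((e * z r - r + r * c - (e * z r - r)) ^ 2 + (r * s - 0) ^ 2)
    with (r ^ 2 * (c ^ 2 + s ^ 2)) by ring. rewrite cs; ring.
- intros ((E3 & E) & H). unfold x1, x2, x3 in E3, E, H; cbn [fst snd] in E3, E, H.
  destruct p as [[p1 p2] p3]; cbn [fst snd] in *.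
  exists ((p1 - (e * z r - r)) / r), (p2 / r). split; [|split].
  + replace (((p1 - (e * z r - r)) / r) ^ 2 + (p2 / r) ^ 2) with
      (((p1 - (e * z r - r)) ^ 2 + (p2 - 0) ^ 2) / r ^ 2) by (field; lra).
    rewrite E. field. lra.
  + apply (Rmult_lt_reg_r r); [exact r0|]. unfold Rdiv.
    rewrite Rmult_assoc, Rinv_l by lra. lra.
  + rewrite E3. apply V3_eq; unfold x1, x2, x3; cbn [fst snd]; field; lra.
Qed.

Lemma ball_coord (p q : V3) (eps : R) : ball p eps q <->
  Rabs (x1 q - x1 p) < eps /\ Rabs (x2 q - x2 p) < eps /\
  Rabs (x3 q - x3 p) < eps.
Proof.
destruct p as [[p1 p2] p3], q as [[q1 q2] q3]. unfold x1, x2, x3; cbn [fst snd].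
split.
- intros [[H1 H2] H3]. now repeat split.
- intros (H1 & H2 & H3). now repeat split.
Qed.

Lemma set_converges_ext (A A' : R -> V3 -> Prop) (F : (R -> Prop) -> Prop)
    (L : V3 -> Prop) : Filter F ->
  F (fun t => forall p, A t p <-> A' t p) ->
  set_converges A F L -> set_converges A' F L.
Proof.
intros FF HA [H1 H2]. split.
- intros p Lp eps e0. generalize (filter_and _ _ HA (H1 p Lp eps e0)).
  apply filter_imp. intros t [Ht (q & Aq & Hq)]. exists q. now rewrite <- Ht.
- intros p Lp. destruct (H2 p Lp) as (eps & e0 & He).
  exists eps; split; [exact e0|]. generalize (filter_and _ _ HA He).
  apply filter_imp. intros t [Ht Hq] q. rewrite <- Ht. apply Hq.
Qed.

Lemma set_converges_comp (A : R -> V3 -> Prop) (F G : (R -> Prop) -> Prop)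
    (g : R -> R) (L : V3 -> Prop) :
  filterlim g F G -> set_converges A G L ->
  set_converges (fun t => A (g t)) F L.
Proof.
intros Hg [H1 H2]. split.
- intros p Lp eps e0. exact (Hg _ (H1 p Lp eps e0)).
- intros p Lp. destruct (H2 p Lp) as (eps & e0 & He).
  exists eps; split; [exact e0|]. exact (Hg _ He).
Qed.

Lemma set_converges_limit_ext (A : R -> V3 -> Prop) (F : (R -> Prop) -> Prop)
    (L L' : V3 -> Prop) : (forall p, L p <-> L' p) ->
  set_converges A F L -> set_converges A F L'.
Proof.
intros HL [H1 H2].
split; [intros p Lp; apply H1, HL, Lp|intros p Lp; apply H2; now rewrite HL].
Qed.

(* [Rd] is the inverse of [z] on the ray, read as the radius at a height, and
   [h1] is the height approached as the radius tends to infinity. *)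
Definition inverse_profile (e a h1 : R) (z Rd : R -> R) : Prop :=
  forall r, a < r ->
    z r < h1 /\ Rd (z r) = r /\ is_derive Rd (z r) (r ^ 2 + e) /\
    forall h, z r < h < h1 -> a < Rd h /\ z (Rd h) = h.

Lemma Rd_limit (e a h1 : R) (z Rd : R -> R) : profile e a z ->
  inverse_profile e a h1 z Rd ->
  filterlim Rd (at_left h1) (Rbar_locally p_infty).
Proof.
intros Hz HR P [M HM].
pose (r := Rmax M a + 1).
assert (Mr : M < r) by (unfold r; generalize (Rmax_l M a); lra).
assert (ar : a < r) by (unfold r; generalize (Rmax_r M a); lra).
destruct (HR r ar) as (r1 & _ & _ & Hh).
assert (d : 0 < h1 - z r) by lra. exists (mkposreal _ d).
intros h Hb hh. apply Rabs_lt_between' in Hb. cbn [pos] in Hb.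
apply HM, (Rlt_trans _ r); [exact Mr|].
destruct (Hh h ltac:(lra)) as [aR zR].
apply Rnot_le_lt; intros [H|H].
- generalize (z_increasing e a z _ _ Hz aR H); lra.
- rewrite H in zR. lra.
Qed.

Lemma z_limit (e a h1 : R) (z Rd : R -> R) : profile e a z ->
  inverse_profile e a h1 z Rd -> forall eps, 0 < eps ->
  Rbar_locally p_infty (fun r => Rabs (z r - h1) < eps).
Proof.
intros Hz HR eps e0.
destruct (HR (a + 1) ltac:(lra)) as (r1 & _ & _ & Hh).
(* This height is within [eps] of [h1] and above [z (a + 1)], where the inverse is defined. *)
pose (h := Rmax (h1 - eps / 2) ((z (a + 1) + h1) / 2)).
assert (H1 := Rmax_l (h1 - eps / 2) ((z (a + 1) + h1) / 2)).
assert (H2 := Rmax_r (h1 - eps / 2) ((z (a + 1) + h1) / 2)). fold h in H1, H2.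
assert (H3 : h < h1) by (unfold h; apply Rmax_lub_lt; lra).
destruct (Hh h ltac:(lra)) as [aR zR].
exists (Rd h). intros r Hr.
assert (H4 := z_increasing e a z _ _ Hz aR Hr).
destruct (HR r ltac:(lra)) as (r2 & _).
apply Rabs_lt_between'. lra.
Qed.

(* [Y] is the part of the limit line that is reached.  With u = r (cos v - 1) and
   w = r sin v one has 2 r u + u^2 + w^2 = 0, so u tends to 0 on bounded sets. *)
Lemma arcs_converge (e h1 : R) (z k : R -> R) (Y : R -> Prop) :
  e ^ 2 = 1 ->
  (forall eps, 0 < eps ->
     Rbar_locally p_infty (fun r => Rabs (z r - h1) < eps)) ->
  (forall y, Y y -> forall eps, 0 < eps ->
     exists y', Rabs (y' - y) < eps /\
       Rbar_locally p_infty (fun r => forall c,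
         0 < c -> c ^ 2 = 1 - (y' / r) ^ 2 -> c < k r)) ->
  (forall y B, ~ Y y ->
     exists eps, 0 < eps /\
       Rbar_locally p_infty (fun r => forall c s,
         c ^ 2 + s ^ 2 = 1 -> c < k r -> Rabs (r * s - y) < eps ->
         Rabs (r * (c - 1)) < B -> False)) ->
  set_converges (arc e z k) (Rbar_locally p_infty)
    (fun p => x1 p = e * h1 /\ x3 p = h1 /\ Y (x2 p)).
Proof.
intros e2 Hz H1 H2.
assert (e1 : Rabs e = 1).
{ assert (H : Rabs e ^ 2 = 1) by (rewrite pow2_abs; exact e2).
  generalize (Rabs_pos e); nra. }
split.
- intros p (E1 & E3 & Yp) eps e0.
  destruct (H1 (x2 p) Yp eps e0) as (y & Hy & Hk).
  generalize (filter_and (F := Rbar_locally p_infty) _ _ (Hz (eps / 2) ltac:(lra)) Hk).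
  (* The bound [Rabs y + 1] ensures [(y / r)^2 < 1]; the last term gives [r (1 - c) <= eps / 2],
     through [r * r (1 - c) (1 + c) = y^2]. *)
  assert (big : Rbar_locally p_infty
    (fun r => Rabs y + 1 + 2 * y ^ 2 / eps < r)) by (eexists; intros x Hx; exact Hx).
  intros HF. generalize (filter_and (F := Rbar_locally p_infty) _ _ HF big). clear HF big.
  apply (filter_imp (F := Rbar_locally p_infty)). intros r [[zr kr] rb].
  assert (y2 : 0 <= y ^ 2) by apply pow2_ge_0.
  assert (q0 : 0 <= 2 * y ^ 2 / eps) by (apply Rdiv_le_0_compat; lra).
  assert (ya := Rabs_pos y).
  assert (r0 : 0 < r) by lra.
  assert (yr : y ^ 2 < r ^ 2) by (rewrite <- (pow2_abs y); nra).
  assert (u0 : 0 < 1 - (y / r) ^ 2).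
  { replace (1 - (y / r) ^ 2) with ((r ^ 2 - y ^ 2) / r ^ 2) by (field; lra).
    apply Rdiv_lt_0_compat; [lra|nra]. }
  set (c := sqrt (1 - (y / r) ^ 2)).
  assert (c0 : 0 < c) by now apply sqrt_lt_R0.
  assert (c2 : c ^ 2 = 1 - (y / r) ^ 2) by (apply pow2_sqrt; lra).
  exists (e * z r - r + r * c, y, z r). split.
  + exists c, (y / r). split; [lra|split; [now apply kr|]].
    apply V3_eq; unfold x1, x2, x3; cbn [fst snd]; field; lra.
  + apply ball_coord; unfold x1 at 1, x2 at 1, x3 at 1; cbn [fst snd].
    split; [|split; [exact Hy|rewrite E3; lra]].
    rewrite E1.
    replace (e * z r - r + r * c - e * h1) with
      (e * (z r - h1) + - (r * (1 - c))) by ring.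
    eapply Rle_lt_trans; [apply Rabs_triang|].
    rewrite Rabs_mult, e1, Rmult_1_l, Rabs_Ropp.
    assert (c1 : c <= 1) by (assert (0 <= (y / r) ^ 2) by apply pow2_ge_0; nra).
    rewrite (Rabs_pos_eq (r * (1 - c))) by nra.
    enough (r * (1 - c) <= eps / 2) by lra.
    assert (E : r * (r * (1 - c) * (1 + c)) = y ^ 2).
    { replace (r * (r * (1 - c) * (1 + c))) with (r ^ 2 * (1 - c ^ 2)) by ring.
      rewrite c2. field. lra. }
    assert (F : 2 * y ^ 2 < r * eps).
    { replace (2 * y ^ 2) with (2 * y ^ 2 / eps * eps) by (field; lra). nra. }
    set (X := r * (1 - c)) in *. assert (X0 : 0 <= X) by (unfold X; nra).
    assert (0 <= r * (X * c)) by (repeat apply Rmult_le_pos; lra).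
    apply (Rmult_le_reg_l r); lra.
- intros p Np.
  destruct (Req_dec (x3 p) h1) as [E3|E3].
  + destruct (Req_dec (x1 p) (e * h1)) as [E1|E1].
    * assert (NY : ~ Y (x2 p)) by tauto.
      (* The number 2 bounds [|r (c - 1)|]: at most 1 comes from the radius of the ball and 1 from
         the height. *)
      destruct (H2 (x2 p) 2 NY) as (eps & e0 & He).
      exists (Rmin eps 1). split; [apply Rmin_pos; lra|].
      generalize (filter_and (F := Rbar_locally p_infty) _ _ He (Hz 1 Rlt_0_1)).
      apply (filter_imp (F := Rbar_locally p_infty)). intros r [Hr zr] q (c & s & cs & ck & ->) Hb.
      apply ball_coord in Hb; unfold x1 at 1, x2 at 1, x3 at 1 in Hb;
        cbn [fst snd] in Hb. destruct Hb as (B1 & B2 & _).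
      apply (Hr c s cs ck).
      -- eapply Rlt_le_trans; [exact B2|apply Rmin_l].
      -- replace (r * (c - 1)) with
           ((e * z r - r + r * c - x1 p) + - (e * (z r - h1))) by (rewrite E1; ring).
         eapply Rle_lt_trans; [apply Rabs_triang|].
         rewrite Rabs_Ropp, Rabs_mult, e1.
         generalize (Rmin_r eps 1); lra.
    * set (d := Rabs (x1 p - e * h1)).
      assert (d0 : 0 < d) by (apply Rabs_pos_lt; lra).
      (* With [eps <= d / 4], both the ball and the height error move [u] by less than [d / 4], so
         [d / 2 < |u| < B], while [|w| < C]. Then [r d < 2 r |u| = u^2 + w^2 < B^2 + C^2], which
         fails for large [r]. *)
      pose (B := 2 * d). pose (C := Rabs (x2 p) + 1).
      pose (eps := Rmin 1 (d / 4)).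
      assert (e0 : 0 < eps) by (apply Rmin_pos; lra).
      assert (ea := Rmin_l 1 (d / 4)). assert (eb := Rmin_r 1 (d / 4)).
      fold eps in ea, eb.
      exists eps. split; [exact e0|].
      assert (big : Rbar_locally p_infty
        (fun r => (B ^ 2 + C ^ 2) / d < r)) by (eexists; intros x Hx; exact Hx).
      generalize (filter_and (F := Rbar_locally p_infty) _ _ (Hz eps e0) big).
      apply (filter_imp (F := Rbar_locally p_infty)). intros r [zr rb] q (c & s & cs & ck & ->) Hb.
      apply ball_coord in Hb; unfold x1 at 1, x2 at 1, x3 at 1 in Hb;
        cbn [fst snd] in Hb. destruct Hb as (B1 & B2 & _).
      assert (S : r ^ 2 * (c ^ 2 + s ^ 2) = r ^ 2) by (rewrite cs; ring).
      set (u := r * (c - 1)). set (w := r * s) in *.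
      assert (S' : 2 * r * u + u ^ 2 + w ^ 2 = 0) by (unfold u, w; lra).
      assert (ue : u - (x1 p - e * h1) =
        (e * z r - r + r * c - x1 p) + - (e * (z r - h1))) by (unfold u; ring).
      assert (U : Rabs (u - (x1 p - e * h1)) < d / 2).
      { rewrite ue. eapply Rle_lt_trans; [apply Rabs_triang|].
        rewrite Rabs_Ropp, Rabs_mult, e1. lra. }
      assert (ul : d / 2 < Rabs u).
      { generalize (Rabs_triang_inv (x1 p - e * h1) u).
        rewrite (Rabs_minus_sym _ u). fold d. lra. }
      assert (uu : Rabs u < B).
      { generalize (Rabs_triang_inv u (x1 p - e * h1)). fold d. unfold B. lra. }
      assert (wu : Rabs w < C).
      { generalize (Rabs_triang_inv w (x2 p)). unfold C. lra. }
      assert (u2 : u ^ 2 < B ^ 2).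
      { rewrite <- (pow2_abs u). generalize (Rabs_pos u); nra. }
      assert (w2 : w ^ 2 < C ^ 2).
      { rewrite <- (pow2_abs w). generalize (Rabs_pos w); nra. }
      assert (R1 : B ^ 2 + C ^ 2 < r * d).
      { replace (B ^ 2 + C ^ 2) with ((B ^ 2 + C ^ 2) / d * d) by (field; lra).
        now apply Rmult_lt_compat_r. }
      assert (r0 : 0 < r) by nra.
      assert (2 * r * Rabs u = u ^ 2 + w ^ 2); [|nra].
      assert (u0 : u <= 0) by nra.
      rewrite Rabs_left1 by exact u0. lra.
  + set (d := Rabs (x3 p - h1)).
    assert (d0 : 0 < d) by (apply Rabs_pos_lt; lra).
    exists (d / 2). split; [lra|].
    generalize (Hz (d / 2) ltac:(lra)).
    apply (filter_imp (F := Rbar_locally p_infty)). intros r zr q (c & s & cs & ck & ->) Hb.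
    apply ball_coord in Hb; unfold x1 at 1, x2 at 1, x3 at 1 in Hb;
      cbn [fst snd] in Hb. destruct Hb as (_ & _ & B3).
    unfold d in *. rewrite Rabs_minus_sym in B3.
    generalize (Rabs_triang (x3 p - z r) (z r - h1)).
    replace (x3 p - z r + (z r - h1)) with (x3 p - h1) by ring. lra.
Qed.

(** * The conelike point *)

(** The mean value theorem gives [atan r = r / (1 + x^2)] for some [x] between 0 and [r]. *)
Lemma atan_bounds (r : R) : 0 < r -> r / (1 + r ^ 2) <= atan r <= r.
Proof.
intros r0.
destruct (MVT_gen atan 0 r (fun x => / (1 + x ^ 2))) as (x & Hx & E).
- intros x _. replace (1 + x ^ 2) with (1 + Rsqr x) by (unfold Rsqr; ring).
  apply is_derive_atan.
- intros x _. apply continuity_pt_filterlim.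
  apply (ex_derive_continuous (V := R_NormedModule)).
  eexists; apply is_derive_atan.
- rewrite Rmin_left, Rmax_right in Hx by lra.
  rewrite atan_0 in E. replace (atan r) with (/ (1 + x ^ 2) * r) by lra.
  assert (x ^ 2 <= r ^ 2) by nra. assert (x2 := pow2_ge_0 x).
  split.
  + unfold Rdiv. rewrite Rmult_comm. apply Rmult_le_compat_r; [lra|].
    apply Rinv_le_contravar; lra.
  + rewrite <- (Rmult_1_l r) at 2. apply Rmult_le_compat_r; [lra|].
    rewrite <- Rinv_1. apply Rinv_le_contravar; lra.
Qed.

(** The centres of the circles are displaced by [r - atan r]; being of third order, this
    displacement disappears in the blow-up. *)
Lemma atan_cubic (r : R) : 0 < r -> 0 <= r - atan r <= r ^ 3.
Proof.
intros r0. destruct (atan_bounds r r0) as [H1 H2]. split; [lra|].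
assert (r2 := pow2_ge_0 r).
enough (r - r / (1 + r ^ 2) <= r ^ 3) by lra.
replace (r - r / (1 + r ^ 2)) with (r ^ 3 * / (1 + r ^ 2)) by (field; lra).
rewrite <- (Rmult_1_r (r ^ 3)) at 2. apply Rmult_le_compat_l.
- apply pow_le; lra.
- rewrite <- Rinv_1. apply Rinv_le_contravar; lra.
Qed.

(** Bounds the radius by the height: below height [PI / 4] the radius is less than 1, where
    [1 / (1 + r^2) >= 1 / 2]. *)
Lemma small_atan (r : R) : 0 < r -> atan r < PI / 4 -> r <= 2 * atan r.
Proof.
intros r0 H. destruct (atan_bounds r r0) as [H1 _].
assert (r1 : r < 1).
{ apply Rnot_le_lt; intros [R1|R1].
  - generalize (atan_increasing 1 r R1). rewrite atan_1; lra.
  - subst r. rewrite atan_1 in H; lra. }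
assert (r / 2 <= r / (1 + r ^ 2)); [|lra].
apply Rmult_le_compat_l; [lra|]. apply Rinv_le_contravar; nra.
Qed.

Lemma at_right_0 (P : R -> Prop) (d : R) : 0 < d ->
  (forall t, 0 < t < d -> P t) -> at_right 0 P.
Proof.
intros d0 HP. exists (mkposreal d d0). intros t Ht t0. apply HP.
apply Rabs_lt_between' in Ht. cbn [pos] in Ht. lra.
Qed.

Lemma cone_approx (p : V3) (eps : R) : half_light_cone p -> 0 < eps ->
  exists h c s, 0 < h /\ c ^ 2 + s ^ 2 = 1 /\ c < 1 /\
    Rabs (h * c - x1 p) < eps /\ Rabs (h * s - x2 p) < eps /\
    Rabs (h - x3 p) < eps.
Proof.
intros [Hp h0] e0. unfold lor in Hp. destruct p as [[a b] h].
unfold x1, x2, x3 in *; cbn [fst snd] in *.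
destruct h0 as [h0|h0].
- assert (c2 : (a / h) ^ 2 + (b / h) ^ 2 = 1).
  { replace ((a / h) ^ 2 + (b / h) ^ 2) with ((a * a + b * b) / (h * h))
      by (field; lra).
    replace (a * a + b * b) with (h * h) by lra. field. lra. }
  destruct (Rlt_le_dec (a / h) 1) as [c1|c1].
  + exists h, (a / h), (b / h). repeat split; try assumption.
    * replace (h * (a / h) - a) with 0 by (field; lra). now rewrite Rabs_R0.
    * replace (h * (b / h) - b) with 0 by (field; lra). now rewrite Rabs_R0.
    * rewrite Rminus_diag, Rabs_R0; exact e0.
  + assert (a = h).
    { assert (a / h = 1) by nra. replace a with (a / h * h) by (field; lra).
      rewrite H; ring. }
    assert (b = 0) by nra. subst a b.
    pose (u := Rmin 1 (eps / (4 * h))).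
    assert (u0 : 0 < u) by (apply Rmin_pos; [lra|apply Rdiv_lt_0_compat; lra]).
    assert (u1 : u <= 1) by apply Rmin_l.
    assert (uh : 4 * h * u <= eps).
    { assert (H : u <= eps / (4 * h)) by apply Rmin_r.
      apply (Rmult_le_compat_l (4 * h)) in H; [|lra].
      replace (4 * h * (eps / (4 * h))) with eps in H by (field; lra). exact H. }
    (* The direction is that of the removed point; it is replaced by a nearby
       rational point of the circle. *)
    assert (v0 : 0 < / (1 + u ^ 2) <= 1).
    { split; [apply Rinv_0_lt_compat; nra|].
      rewrite <- Rinv_1. apply Rinv_le_contravar; nra. }
    assert (v1 : / (1 + u ^ 2) * (1 + u ^ 2) = 1) by (field; nra).
    set (v := / (1 + u ^ 2)) in *.
    exists h, ((1 - u ^ 2) * v), (2 * u * v).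
    assert (u2 : 0 < u ^ 2 <= u) by nra.
    assert (uv : 0 < u * v <= u) by nra.
    assert (uuv : 0 < u ^ 2 * v <= u) by nra.
    assert (cv : (1 - u ^ 2) * v = 1 - 2 * (u ^ 2 * v)) by lra.
    split; [exact h0|split; [|split; [|split; [|split]]]].
    * replace (((1 - u ^ 2) * v) ^ 2 + (2 * u * v) ^ 2)
        with ((v * (1 + u ^ 2)) ^ 2) by ring. rewrite v1; ring.
    * lra.
    * rewrite cv. apply Rabs_lt_between. nra.
    * apply Rabs_lt_between. nra.
    * rewrite Rminus_diag, Rabs_R0; exact e0.
(* The apex is approximated by a low point in the direction opposite to the puncture. *)
- exists (eps / 2), (-1), 0. assert (a = 0) by nra. assert (b = 0) by nra.
  subst a b. rewrite <- h0.
  repeat split; try lra; apply Rabs_lt_between; lra.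
Qed.

Lemma dom_plus_cut : cut_by dom_plus (fun r => 0 < r) (fun _ => 1).
Proof.
intros r c s cs; split.
- intros (v & (r0 & Hv) & <- & <-). split; [exact r0|].
  rewrite <- cos_2PI. destruct (Rle_lt_dec v PI) as [H|H].
  + rewrite cos_2PI, <- cos_0. apply cos_decreasing_1; lra.
  + apply cos_increasing_1; lra.
- intros [r0 c1]. destruct (polar_angle c s cs) as (v & Hv & <- & <-).
  exists v. split; [|now split]. split; [exact r0|].
  assert (v <> 0) by (intros ->; rewrite cos_0 in c1; lra). lra.
Qed.

Lemma image_plus_iff (p : V3) : image (RX 1 atan) dom_plus p <->
  exists r c s, 0 < r /\ c ^ 2 + s ^ 2 = 1 /\ c < 1 /\
    p = (atan r - r + r * c, r * s, atan r).
Proof.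
split.
- intros (r & v & Hv & E).
  destruct (proj1 (slice_arc 1 atan _ _ _ r p dom_plus_cut)) as (r0 & c & s & H);
    [now exists v|].
  exists r, c, s. rewrite Rmult_1_l in H. tauto.
- intros (r & c & s & r0 & cs & c1 & E).
  destruct (proj2 (slice_arc 1 atan _ _ _ r p dom_plus_cut)) as (v & Hv & Ev).
  + split; [exact r0|]. exists c, s. rewrite Rmult_1_l. tauto.
  + now exists r, v.
Qed.

Lemma conelike_shrink (eps : R) : 0 < eps -> at_right 0 (fun h =>
  (exists q, leaf (image (RX 1 atan) dom_plus) h q) /\
  (forall q, leaf (image (RX 1 atan) dom_plus) h q -> ball ((0, 0, 0) : V3) eps q)).
Proof.
intros e0. assert (P := PI_RGT_0).
(* A height below [eps / 6] forces a radius below [eps / 3], and no coordinate exceeds twice the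
   radius. *)
apply (at_right_0 _ (Rmin (PI / 4) (eps / 6))).
{ apply Rmin_pos; lra. }
intros h [h0 hd].
assert (h1 := Rmin_l (PI / 4) (eps / 6)). assert (h2 := Rmin_r (PI / 4) (eps / 6)).
split.
- exists (h - tan h + tan h * (-1), tan h * 0, h).
  split; [|reflexivity]. apply image_plus_iff. exists (tan h), (-1), 0.
  rewrite atan_tan by lra. repeat split; try lra. apply tan_gt_0; lra.
- intros q [Sq Hq]. apply image_plus_iff in Sq. destruct Sq as (r & c & s & r0 & cs & c1 & ->).
  change (atan r = h) in Hq. subst h.
  assert (H := small_atan r r0 ltac:(lra)). destruct (atan_bounds r r0) as [_ H'].
  apply ball_coord; unfold x1, x2, x3; cbn [fst snd].
  assert (-1 <= c <= 1) by nra. assert (-1 <= s <= 1) by nra.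
  repeat split; apply Rabs_lt_between; nra.
Qed.

(** A surface point of radius [r] is the cone point [(r cos v, r sin v, r)] shifted by
    [-(r - atan r)] along [(1, 0, 1)]. After dilation by [1 / t] the shift is
    [mu = (r - atan r) / t], of order [t^2] on bounded sets, where [r] is of order [t]. *)
Lemma cone_blow_up : set_converges
  (fun t w => image (RX 1 atan) dom_plus (plus ((0, 0, 0) : V3) (scal t w))) (at_right 0) half_light_cone.
Proof.
split.
- intros p Cp eps e0.
  destruct (cone_approx p (eps / 2) Cp ltac:(lra))
    as (h & c & s & h0 & cs & c1 & E1 & E2 & E3).
  assert (h3 : 0 < h ^ 3) by now apply pow_lt.
  apply (at_right_0 _ (Rmin 1 (eps / (2 * h ^ 3)))).
  { apply Rmin_pos; [lra|]. apply Rdiv_lt_0_compat; lra. }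
  intros t [t0 td].
  assert (t1 : t < 1) by (eapply Rlt_le_trans; [exact td|apply Rmin_l]).
  assert (t2 : t * h ^ 3 < eps / 2).
  { apply Rlt_le_trans with (eps / (2 * h ^ 3) * h ^ 3).
    - apply Rmult_lt_compat_r; [exact h3|].
      eapply Rlt_le_trans; [exact td|apply Rmin_r].
    - right; field; lra. }
  assert (r0 : 0 < t * h) by now apply Rmult_lt_0_compat.
  destruct (atan_cubic (t * h) r0) as [m0 m1].
  set (r := t * h) in *. set (mu := (r - atan r) / t).
  assert (mu0 : 0 <= mu) by (apply Rdiv_le_0_compat; lra).
  assert (mu1 : mu < eps / 2).
  { apply Rle_lt_trans with (t * h ^ 3); [|exact t2].
    apply (Rmult_le_reg_l t); [exact t0|].
    replace (t * mu) with (r - atan r) by (unfold mu; field; lra).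
    apply Rle_trans with (r ^ 3); [exact m1|].
    replace (r ^ 3) with (t * (t * (t * h ^ 3))) by (unfold r; ring).
    apply Rmult_le_compat_l; [lra|].
    rewrite <- (Rmult_1_l (t * h ^ 3)) at 2.
    apply Rmult_le_compat_r; nra. }
  exists (h * c - mu, h * s, h - mu). split.
  + apply image_plus_iff. exists r, c, s. split; [exact r0|split; [exact cs|split; [exact c1|]]].
    rewrite plus_scal_coord.
    apply V3_eq; unfold x1, x2, x3, mu, r; cbn [fst snd]; field; lra.
  + apply ball_coord.
    change (x1 (h * c - mu, h * s, h - mu)) with (h * c - mu).
    change (x2 (h * c - mu, h * s, h - mu)) with (h * s).
    change (x3 (h * c - mu, h * s, h - mu)) with (h - mu).
    apply Rabs_lt_between in E1, E2, E3.
    repeat split; apply Rabs_lt_between; lra.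
- intros p Np. destruct (Rlt_le_dec (x3 p) 0) as [p3|p3].
  { exists (- x3 p). split; [lra|].
    apply (at_right_0 _ 1 Rlt_0_1). intros t [t0 _] q Sq Hb.
    apply image_plus_iff in Sq. destruct Sq as (r & c & s & r0 & _ & _ & E).
    apply ball_coord in Hb. destruct Hb as (_ & _ & Hb).
    apply Rabs_lt_between in Hb.
    rewrite plus_scal_coord in E. apply (f_equal x3) in E.
    change (0 + t * x3 q = atan r) in E.
    destruct (atan_bounds r r0) as [H _].
    assert (0 < r / (1 + r ^ 2)) by (apply Rdiv_lt_0_compat; nra). nra. }
  assert (f0 : lor p p <> 0) by (intros f0; apply Np; now split).
  set (d := Rabs (lor p p)). assert (d0 : 0 < d) by now apply Rabs_pos_lt.
  set (N := 1 + Rabs (x1 p) + Rabs (x2 p) + Rabs (x3 p)).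
  assert (A1 := Rabs_pos (x1 p)). assert (A2 := Rabs_pos (x2 p)).
  assert (A3 := Rabs_pos (x3 p)).
  assert (N1 : 1 <= N) by (unfold N; lra).
  (* Coordinates in the ball stay below [N], so each of the three squares changes by at most
     [2 N eps], in total by at most [d / 2]. The other half of [d] is left for the shift. *)
  set (eps := Rmin 1 (d / (12 * N))).
  assert (e0 : 0 < eps).
  { apply Rmin_pos; [lra|]. apply Rdiv_lt_0_compat; lra. }
  assert (e1 : eps <= 1) by apply Rmin_l.
  assert (eN : 6 * N * eps <= d / 2).
  { apply Rle_trans with (6 * N * (d / (12 * N))).
    - apply Rmult_le_compat_l; [lra|apply Rmin_r].
    - right; field; lra. }
  exists eps. split; [exact e0|].
  assert (N4 : 0 < N ^ 4) by (apply pow_lt; lra).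
  assert (P := PI_RGT_0).
  (* The bound [PI / (4 N)] keeps heights below [PI / 4], as [small_atan] requires. The bound
     [d / (64 N^4)] makes [4 mu N < d / 2], given [mu <= 8 t N^3]. *)
  apply (at_right_0 _ (Rmin (Rmin 1 (PI / (4 * N))) (d / (64 * N ^ 4)))).
  { repeat apply Rmin_pos; try lra; apply Rdiv_lt_0_compat; lra. }
  intros t [t0 td] q Sq Hb.
  assert (ta := Rlt_le_trans _ _ _ td (Rmin_l _ _)).
  assert (t1 := Rlt_le_trans _ _ _ ta (Rmin_l _ _)).
  assert (tP := Rlt_le_trans _ _ _ ta (Rmin_r _ _)).
  assert (tN := Rlt_le_trans _ _ _ td (Rmin_r _ _)). clear ta td.
  assert (tP' : t * N < PI / 4).
  { replace (PI / 4) with (PI / (4 * N) * N) by (field; lra). nra. }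
  assert (tN' : 64 * (t * N ^ 4) < d).
  { replace d with (64 * (d / (64 * N ^ 4) * N ^ 4)) by (field; lra). nra. }
  apply image_plus_iff in Sq. destruct Sq as (r & c & s & r0 & cs & c1 & E).
  rewrite plus_scal_coord in E.
  assert (F1 := f_equal x1 E). assert (F2 := f_equal x2 E).
  assert (F3 := f_equal x3 E). clear E.
  change (0 + t * x1 q = atan r - r + r * c) in F1.
  change (0 + t * x2 q = r * s) in F2. change (0 + t * x3 q = atan r) in F3.
  apply ball_coord in Hb. destruct Hb as (B1 & B2 & B3).
  assert (near : forall x y, Rabs (y - x) < eps -> Rabs x <= N - 1 ->
    Rabs y <= N /\ Rabs (y ^ 2 - x ^ 2) <= 2 * N * eps).
  { intros x y Hxy Hx.
    assert (Hy : Rabs y <= N).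
    { generalize (Rabs_triang_inv y x). lra. }
    split; [exact Hy|].
    replace (y ^ 2 - x ^ 2) with ((y - x) * (y + x)) by ring.
    rewrite Rabs_mult. generalize (Rabs_triang y x).
    generalize (Rabs_pos (y - x)), (Rabs_pos (y + x)). nra. }
  destruct (near _ _ B1) as [Q1 G1]; [unfold N; lra|].
  destruct (near _ _ B2) as [Q2 G2]; [unfold N; lra|].
  destruct (near _ _ B3) as [Q3 G3]; [unfold N; lra|].
  apply Rabs_le_between in Q1, Q2, Q3, G1, G2, G3.
  assert (rN : r <= 2 * (t * N)).
  { assert (atan r <= t * N) by (rewrite <- F3; nra).
    generalize (small_atan r r0 ltac:(lra)). lra. }
  destruct (atan_cubic r r0) as [m0 m1].
  set (mu := (r - atan r) / t).
  assert (Em : t * mu = r - atan r) by (unfold mu; field; lra).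
  assert (mu0 : 0 <= mu) by (apply Rdiv_le_0_compat; lra).
  assert (mu1 : mu <= 8 * (t * N ^ 3)).
  { apply (Rmult_le_reg_l t); [exact t0|]. rewrite Em.
    apply Rle_trans with ((2 * (t * N)) ^ 3).
    - apply Rle_trans with (r ^ 3); [exact m1|]. apply pow_incr; lra.
    - replace ((2 * (t * N)) ^ 3) with (t * (8 * (t * (t * N ^ 3)))) by ring.
      apply Rmult_le_compat_l; [lra|]. apply Rmult_le_compat_l; [lra|].
      rewrite <- (Rmult_1_l (t * N ^ 3)) at 2.
      apply Rmult_le_compat_r; [|lra].
      apply Rmult_le_pos; [lra|apply pow_le; lra]. }
  (* Dilated equation of the surface: the equation of the cone up to a term that vanishes with
     [mu]. *)
  assert (Eq : x1 q ^ 2 + x2 q ^ 2 - x3 q ^ 2 = 2 * mu * (x3 q - x1 q)).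
  { apply (Rmult_eq_reg_l (t ^ 2)); [|apply pow_nonzero; lra].
    assert (S2 : r ^ 2 * (c ^ 2 + s ^ 2) = r ^ 2) by (rewrite cs; ring).
    transitivity ((t * x1 q) ^ 2 + (t * x2 q) ^ 2 - (t * x3 q) ^ 2); [ring|].
    transitivity (2 * (t * mu) * (t * x3 q - t * x1 q)); [|ring].
    rewrite Em. replace (t * x1 q) with (atan r - r + r * c) by lra.
    replace (t * x2 q) with (r * s) by lra.
    replace (t * x3 q) with (atan r) by lra. lra. }
  assert (M : 2 * mu * (2 * N) < d / 2).
  { assert (mu * N <= 8 * (t * N ^ 3) * N) by (apply Rmult_le_compat_r; lra).
    replace (8 * (t * N ^ 3) * N) with (8 * (t * N ^ 4)) in H by ring. lra. }
  assert (Mq : Rabs (2 * mu * (x3 q - x1 q)) < d / 2).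
  { apply Rabs_lt_between. nra. }
  apply Rabs_lt_between in Mq.
  assert (L : lor p p = x1 p ^ 2 + x2 p ^ 2 - x3 p ^ 2) by (unfold lor; ring).
  assert (D : Rabs (lor p p) < d) by (apply Rabs_lt_between; lra).
  unfold d in D. lra.
Qed.

(** * The two surfaces *)

Definition z_minus (r : R) : R := / 2 * ln ((r - 1) / (r + 1)).
(** This is [- coth h], as [z_minus] is minus the inverse hyperbolic cotangent. *)
Definition z_minus_inv (h : R) : R := (1 + exp (2 * h)) / (1 - exp (2 * h)).

Lemma profile_plus : profile 1 0 atan.
Proof.
split; [ring|]. intros r r0. split; [exact r0|split; [nra|]].
replace (r ^ 2 + 1) with (1 + Rsqr r) by (unfold Rsqr; ring).
apply is_derive_atan.
Qed.

Lemma inverse_profile_plus : inverse_profile 1 0 (PI / 2) atan tan.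
Proof.
intros r r0. destruct (atan_bound r) as [_ B].
split; [exact B|split; [apply tan_atan|split]].
- replace (r ^ 2 + 1) with (tan (atan r) ^ 2 + 1) by (rewrite tan_atan; ring).
  apply is_derive_tan. generalize (cos_gt_0 (atan r)), (atan_bound r). lra.
- intros h [H1 H2]. assert (h0 : 0 < h).
  { rewrite <- atan_0. eapply Rlt_trans; [|exact H1]. now apply atan_increasing. }
  split; [apply tan_gt_0; lra|apply atan_tan; lra].
Qed.

Lemma profile_minus : profile (-1) 1 z_minus.
Proof.
split; [ring|]. intros r r1. split; [lra|split; [nra|]].
unfold z_minus. auto_derive.
- split; [lra|]. split; [|auto]. apply Rdiv_lt_0_compat; lra.
- field. nra.
Qed.

Lemma exp_z_minus (r : R) : 1 < r -> exp (2 * z_minus r) = (r - 1) / (r + 1).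
Proof.
intros r1. unfold z_minus.
replace (2 * (/ 2 * ln ((r - 1) / (r + 1)))) with (ln ((r - 1) / (r + 1))) by field.
apply exp_ln. apply Rdiv_lt_0_compat; lra.
Qed.

Lemma inverse_profile_minus : inverse_profile (-1) 1 0 z_minus z_minus_inv.
Proof.
intros r r1. assert (E := exp_z_minus r r1).
assert (E1 : (r - 1) / (r + 1) < 1).
{ apply (Rmult_lt_reg_r (r + 1)); [lra|].
  unfold Rdiv; rewrite Rmult_assoc, Rinv_l; lra. }
assert (E2 : 1 - (r - 1) / (r + 1) <> 0) by lra.
split; [|split; [|split]].
- rewrite <- E, <- exp_0 in E1. apply exp_lt_inv in E1. lra.
- unfold z_minus_inv. rewrite E. field. split; lra.
- unfold z_minus_inv. auto_derive; rewrite E; [lra|].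
  field. split; lra.
- intros h [_ h0]. unfold z_minus_inv.
  assert (F1 : exp (2 * h) < 1) by (rewrite <- exp_0; apply exp_increasing; lra).
  assert (F0 := exp_pos (2 * h)). unfold z_minus. set (x := exp (2 * h)) in *.
  assert (G : (1 + x) / (1 - x) - 1 = 2 * x * / (1 - x)) by (field; lra).
  assert (0 < / (1 - x)) by (apply Rinv_0_lt_compat; lra).
  split; [nra|].
  replace (((1 + x) / (1 - x) - 1) / ((1 + x) / (1 - x) + 1)) with x by (field; lra).
  unfold x. rewrite ln_exp. field.
Qed.

(** * Reduction of the two surfaces to the common form and their causal type *)

Lemma X_plus_RX : X_plus = RX 1 atan.
Proof.
apply functional_extensionality; intros r; apply functional_extensionality; intros v.
unfold X_plus. rewrite plus_scal_coord.
apply V3_eq; unfold RX, x1, x2, x3; cbn [fst snd]; ring.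
Qed.

Lemma X_minus_RX : X_minus = RX (-1) z_minus.
Proof.
apply functional_extensionality; intros r; apply functional_extensionality; intros v.
unfold X_minus. rewrite plus_scal_coord.
apply V3_eq; unfold RX, z_minus, x1, x2, x3; cbn [fst snd]; ring.
Qed.

(** For [lambda = 2 e] with [e^2 = 1] the radicand is [q (q + e)^2], so its root is rational in
    [r = sqrt q]. This is why the two surfaces are elementary; the centre function is
    [m = r - e z]. *)
Lemma RX_family_member (e a : R) (z : R -> R) (I : R -> Prop) : profile e a z ->
  (forall q, I q -> 0 < q /\ a < sqrt q) -> family_member (2 * e) I (RX e z).
Proof.
intros Hz HI. exists (fun q => sqrt q - e * z (sqrt q)), (fun q => z (sqrt q)).
intros q Iq. destruct (HI q Iq) as [q0 aq].
assert (s0 : 0 < sqrt q) by now apply sqrt_lt_R0.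
assert (s2 : sqrt q ^ 2 = q) by (apply pow2_sqrt; lra).
destruct (proj2 Hz (sqrt q) aq) as (_ & w0 & dz). rewrite s2 in w0, dz.
assert (e2 := proj1 Hz).
assert (S : sqrt (q ^ 3 + 2 * e * q ^ 2 + q) = sqrt q * (q + e)).
{ replace (q ^ 3 + 2 * e * q ^ 2 + q) with (q * (q + e) ^ 2)
    by (transitivity (q ^ 3 + 2 * e * q ^ 2 + e ^ 2 * q); [ring|rewrite e2; ring]).
  rewrite sqrt_mult; [|lra|apply pow2_ge_0]. now rewrite sqrt_pow2 by lra. }
rewrite S.
assert (Dz : is_derive (fun q => z (sqrt q)) q (1 / (2 * (sqrt q * (q + e))))).
{ replace (1 / (2 * (sqrt q * (q + e)))) with (/ (2 * sqrt q) * / (q + e))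
    by (field; lra).
  apply (is_derive_comp z sqrt); [exact dz|].
  auto_derive; [lra|field; lra]. }
split; [exact Dz|split].
- replace (q / (2 * (sqrt q * (q + e)))) with
    (/ (2 * sqrt q) - e * (1 / (2 * (sqrt q * (q + e))))) by (field; lra).
  apply (is_derive_minus sqrt (fun q => e * z (sqrt q))).
  + auto_derive; [lra|field; lra].
  + now apply is_derive_scal.
- intros v. rewrite plus_scal_coord.
  apply V3_eq; unfold RX, x1, x2, x3; cbn [fst snd]; ring.
Qed.

Lemma RX_spacelike (e a : R) (z : R -> R) (r v : R) : profile e a z -> a < r ->
  cos v < 1 -> 0 < r ^ 2 * (1 - cos v) + 2 * e -> spacelike_at (RX e z) r v.
Proof.
intros Hz ar c1 g0. destruct (proj2 Hz r ar) as (r0 & w0 & _).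
apply spacelike_span2.
- rewrite lor_d2_RX. nra.
- rewrite (gram_RX e a) by assumption.
  assert (0 < / (r ^ 2 + e) ^ 2) by (apply Rinv_0_lt_compat, pow_lt; exact w0).
  assert (0 < r ^ 4) by now apply pow_lt.
  repeat apply Rmult_lt_0_compat; lra.
Qed.

Lemma RX_degenerate_iff (e a : R) (z : R -> R) (r v : R) : profile e a z ->
  a < r -> (degenerate_at (RX e z) r v <->
    (1 - cos v) * (r ^ 2 * (1 - cos v) + 2 * e) = 0).
Proof.
intros Hz ar. destruct (proj2 Hz r ar) as (r0 & w0 & _).
unfold degenerate_at, tangent_plane. rewrite degenerate_span2_iff.
- rewrite (gram_RX e a) by assumption.
  assert (0 < / (r ^ 2 + e) ^ 2) by (apply Rinv_0_lt_compat, pow_lt; exact w0).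
  assert (0 < r ^ 4) by now apply pow_lt.
  assert (r ^ 4 * / (r ^ 2 + e) ^ 2 <> 0) by nra.
  rewrite Rmult_assoc. split; [|intros ->; ring].
  intros E. apply Rmult_integral in E. tauto.
- exact (RX_immersed e a z r v Hz ar).
- rewrite lor_d2_RX. nra.
Qed.

Lemma RX_timelike (e a : R) (z : R -> R) (r v : R) : profile e a z -> a < r ->
  cos v < 1 -> r ^ 2 * (1 - cos v) + 2 * e < 0 -> timelike_at (RX e z) r v.
Proof.
intros Hz ar c1 g0. destruct (proj2 Hz r ar) as (r0 & w0 & _).
apply timelike_span2.
- exact (RX_immersed e a z r v Hz ar).
- rewrite lor_d2_RX. nra.
- rewrite (gram_RX e a) by assumption.
  assert (0 < / (r ^ 2 + e) ^ 2) by (apply Rinv_0_lt_compat, pow_lt; exact w0).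
  assert (0 < r ^ 4) by now apply pow_lt.
  assert (0 < r ^ 4 * / (r ^ 2 + e) ^ 2 * (1 - cos v)) by
    (repeat apply Rmult_lt_0_compat; lra).
  nra.
Qed.

(** The radii [r1] and [r2] supply the two leaves, with interior left halves, on which rotational
    symmetry is refuted. *)
Lemma RX_riemann (e a h1 : R) (z Rd : R -> R) (D : R -> R -> Prop)
    (I : R -> Prop) (k : R -> R) (r1 r2 : R) :
  profile e a z -> inverse_profile e a h1 z Rd -> cut_by D I k ->
  (forall r, I r -> a < r) -> (forall r, I r -> -1 < k r <= 1) ->
  (forall r v, D r v -> cos v < 1 /\ 0 < r ^ 2 * (1 - cos v) + 2 * e) ->
  a < r1 < r2 ->
  (forall r v, r = r1 \/ r = r2 -> 0 < v < 2 * PI -> cos v <= 0 ->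
     locally ((r, v) : R * R) (fun w : R * R => D (fst w) (snd w))) ->
  riemann_zmc_example (RX e z) D.
Proof.
intros Hz HR HD HI Hk Hdef Hr Hint.
assert (HDa : forall r v, D r v -> a < r).
{ intros r v Drv. apply HI.
  apply (slice_arc e z D I k r (RX e z r v) HD). now exists v. }
split; [now apply (RX_smooth e a)|split; [|split]].
- intros r v Drv. assert (ar := HDa r v Drv). destruct (Hdef r v Drv) as [c1 g0].
  split; [now apply (RX_immersed e a)|split].
  + rewrite (RX_degenerate_iff e a) by assumption. nra.
  + now apply (RX_minimal e a).
- apply (RX_not_rotational e a z Rd D r1 r2); auto.
  intros u au. destruct (HR u au) as (_ & H1 & H2 & _). now split.
- intros p Sp. destruct (image_height e z D I k p HD Sp) as (r & Ir & ->).
  apply (arc_is_hcircle_arc e z k r).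
  + now apply (proj2 Hz), HI.
  + now apply Hk.
  + intros q. now apply (leaf_arc e a z D I).
Qed.

Lemma leaf_is_hcircle_arc (e a : R) (z : R -> R) (D : R -> R -> Prop)
    (I : R -> Prop) (k : R -> R) (p : V3) : profile e a z -> cut_by D I k ->
  (forall r, I r -> a < r) -> (forall r, I r -> -1 < k r <= 1) ->
  image (RX e z) D p -> is_hcircle_arc (leaf (image (RX e z) D) (x3 p)).
Proof.
intros Hz HD HI Hk Sp. destruct (image_height e z D I k p HD Sp) as (r & Ir & ->).
apply (arc_is_hcircle_arc e z k r).
- now apply (proj2 Hz), HI.
- now apply Hk.
- intros q. now apply (leaf_arc e a z D I).
Qed.

Lemma full_arc_is_hcircle (e : R) (z : R -> R) (r : R) (A : V3 -> Prop) :
  0 < r -> (forall p, A p <-> arc e z (fun _ => 2) r p) -> is_hcircle A.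
Proof.
intros r0 HA. exists (e * z r - r, 0, z r), r. split; [exact r0|].
intros p. rewrite HA, arc_hcircle by exact r0. split; [tauto|].
intros Hc. split; [exact Hc|]. destruct Hc as [_ H].
change (x1 (e * z r - r, 0, z r)) with (e * z r - r) in H.
assert (0 <= (x2 p - x2 (e * z r - r, 0, z r)) ^ 2) by apply pow2_ge_0. nra.
Qed.

Lemma punctured_arc_is_punctured_hcircle (e : R) (z : R -> R) (r : R)
    (A : V3 -> Prop) :
  0 < r -> (forall p, A p <-> arc e z (fun _ => 1) r p) ->
  is_punctured_hcircle A.
Proof.
intros r0 HA.
(* The missing point is the one with [cos v = 1], the only point of the circle with maximal [x1]. *)
exists (e * z r - r, 0, z r), r, (e * z r, 0, z r).
split; [exact r0|split].
- unfold hcircle, x1, x2, x3; cbn [fst snd]. split; [reflexivity|ring].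
- intros p. rewrite HA, arc_hcircle by exact r0.
  destruct p as [[p1 p2] p3]. unfold hcircle, x1, x2, x3; cbn [fst snd].
  split; intros [[E3 E] H]; split; try (now split).
  + intros F. injection F as -> _ _. lra.
  + apply Rnot_le_lt; intros H'. apply H.
    assert (0 <= (p2 - 0) ^ 2) by apply pow2_ge_0.
    assert (p1 = e * z r) by nra. assert (p2 = 0) by nra. now subst.
Qed.

(** * Limit lines of the leaves *)

Definition limit_set (e h1 : R) (Y : R -> Prop) : V3 -> Prop :=
  fun p => x1 p = e * h1 /\ x3 p = h1 /\ Y (x2 p).

Lemma limit_set_line (e h1 : R) (p : V3) :
  limit_set e h1 (fun _ => True) p <-> line (e * h1, 0, h1) (0, 1, 0) p.
Proof.
unfold limit_set, line. split.
- intros (E1 & E3 & _). exists (x2 p). rewrite plus_scal_coord.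
  destruct p as [[p1 p2] p3]. unfold x1, x2, x3 in *; cbn [fst snd] in *.
  rewrite E1, E3. apply V3_eq; unfold x1, x2, x3; cbn [fst snd]; ring.
- intros (s & ->). rewrite plus_scal_coord. unfold x1, x2, x3; cbn [fst snd].
  repeat split; ring.
Qed.

Lemma e2_neq_0 : ((0, 1, 0) : V3) <> (zero : V3).
Proof. intros H. apply (f_equal x2) in H. change (1 = 0) in H. lra. Qed.

Lemma limit_set_orthogonal (e h1 : R) :
  is_line_orthogonal_to plane_Pi (limit_set e h1 (fun _ => True)).
Proof.
exists (e * h1, 0, h1), (0, 1, 0).
split; [exact e2_neq_0|split; [apply limit_set_line|]].
intros q q' Hq Hq'. unfold plane_Pi in *. rewrite minus_coord.
change (0 * (x1 q - x1 q') + 1 * (x2 q - x2 q') - 0 * (x3 q - x3 q') = 0).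
rewrite Hq, Hq'. ring.
Qed.

(** Passes from radii to heights: near [h1] the leaf at height [h] is the arc of radius [Rd h], and
    [Rd h] tends to infinity. *)
Lemma leaves_converge (e a h1 b : R) (z Rd : R -> R) (D : R -> R -> Prop)
    (I : R -> Prop) (k : R -> R) (L : V3 -> Prop) :
  profile e a z -> inverse_profile e a h1 z Rd -> cut_by D I k ->
  (forall r, I r -> a < r) -> (forall r, b < r -> I r) ->
  set_converges (arc e z k) (Rbar_locally p_infty) L ->
  set_converges (leaf (image (RX e z) D)) (at_left h1) L.
Proof.
intros Hz HR HD HI Hb HL.
apply (set_converges_ext (fun h => arc e z k (Rd h))); [apply within_filter, locally_filter| |].
2: { apply (set_converges_comp _ _ _ Rd L (Rd_limit e a h1 z Rd Hz HR) HL). }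
assert (E1 : at_left h1 (fun h => b < Rd h)).
{ apply (Rd_limit e a h1 z Rd Hz HR). now exists b. }
destruct (HR (a + 1) ltac:(lra)) as (za & _ & _ & Hh).
assert (E2 : at_left h1 (fun h => z (Rd h) = h)).
{ assert (d : 0 < h1 - z (a + 1)) by lra. exists (mkposreal _ d).
  intros h Hd hh. apply Rabs_lt_between' in Hd. cbn [pos] in Hd. apply Hh. lra. }
generalize (filter_and (F := at_left h1) _ _ E1 E2).
apply (filter_imp (F := at_left h1)).
intros h [H1 H2] p. rewrite <- H2 at 2. symmetry.
apply (leaf_arc e a z D I k); auto.
Qed.

Lemma slices_converge (e b : R) (z : R -> R) (D : R -> R -> Prop)
    (I : R -> Prop) (k : R -> R) (L : V3 -> Prop) :
  cut_by D I k -> (forall r, b < r -> I r) ->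
  set_converges (arc e z k) (Rbar_locally p_infty) L ->
  set_converges (fun r p => exists v, D r v /\ p = RX e z r v)
    (Rbar_locally p_infty) L.
Proof.
intros HD Hb. apply set_converges_ext; [typeclasses eauto|].
exists b. intros r br p. rewrite (slice_arc e z D I k r p HD).
specialize (Hb r br). tauto.
Qed.

Lemma converge_full (e a h1 : R) (z Rd : R -> R) :
  profile e a z -> inverse_profile e a h1 z Rd ->
  set_converges (arc e z (fun _ => 2)) (Rbar_locally p_infty)
    (limit_set e h1 (fun _ => True)).
Proof.
intros Hz HR. apply arcs_converge.
- apply Hz.
- exact (z_limit e a h1 z Rd Hz HR).
- intros y _ eps e0. exists y. rewrite Rminus_diag, Rabs_R0. split; [exact e0|].
  exists 0. intros r r0 c c0 c2. generalize (pow2_ge_0 (y / r)). nra.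
- intros y B H. now destruct H.
Qed.

Lemma converge_punctured (e a h1 : R) (z Rd : R -> R) :
  profile e a z -> inverse_profile e a h1 z Rd ->
  set_converges (arc e z (fun _ => 1)) (Rbar_locally p_infty)
    (limit_set e h1 (fun _ => True)).
Proof.
intros Hz HR. apply arcs_converge.
- apply Hz.
- exact (z_limit e a h1 z Rd Hz HR).
- intros y _ eps e0.
  (* For [y = 0] the nearby point of the circle would be the puncture itself, so [y] is replaced by
     a close nonzero value. *)
  assert (H : exists y', Rabs (y' - y) < eps /\ y' <> 0).
  { destruct (Req_dec y 0) as [->|y0].
    - exists (eps / 2). split; [apply Rabs_lt_between; lra|lra].
    - exists y. rewrite Rminus_diag, Rabs_R0. now split. }
  destruct H as (y' & H & y0). exists y'. split; [exact H|].
  exists 0. intros r r0 c c0 c2.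
  assert (0 < (y' / r) ^ 2); [|nra].
  apply pow2_gt_0. apply Rmult_integral_contrapositive_currified; [exact y0|].
  apply Rinv_neq_0_compat; lra.
- intros y B H. now destruct H.
Qed.

(* On the arc, (r sin v)^2 = r^2 (1 - cos v) (1 + cos v) exceeds
   2 (1 + cos v), which tends to 4 on bounded sets; this is where |x2| >= 2
   comes from. *)
Lemma converge_minus :
  set_converges (arc (-1) z_minus (fun r => 1 - 2 / r ^ 2))
    (Rbar_locally p_infty) (limit_set (-1) 0 (fun y => 2 <= Rabs y)).
Proof.
apply arcs_converge.
- ring.
- exact (z_limit _ _ _ _ _ profile_minus inverse_profile_minus).
- intros y Hy eps e0. exists y. rewrite Rminus_diag, Rabs_R0. split; [exact e0|].
  exists 2. intros r r2 c c0 c2.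
  assert (y2 : 4 <= y ^ 2) by (rewrite <- pow2_abs; nra).
  set (x := / r ^ 2).
  assert (x0 : 0 < x) by (apply Rinv_0_lt_compat; nra).
  assert (x1 : x * 4 < 1).
  { unfold x. apply (Rmult_lt_reg_r (r ^ 2)); [nra|].
    replace (/ r ^ 2 * 4 * r ^ 2) with 4 by (field; lra). nra. }
  replace ((y / r) ^ 2) with (y ^ 2 * x) in c2 by (unfold x; field; lra).
  (* Here [c^2 <= 1 - 4 x < (1 - 2 x)^2] and [1 - 2 x > 0]. *)
  unfold Rdiv. fold x. nra.
- intros y B Hy. apply Rnot_le_lt in Hy.
  assert (ya := Rabs_pos y).
  exists ((2 - Rabs y) / 2). split; [lra|].
  (* The midpoint of [Rabs y] and 2, an upper bound for [|r s|] within the chosen distance of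
     [y]. *)
  set (b := 1 + Rabs y / 2). assert (b2 : 0 < 4 - b ^ 2) by (unfold b; nra).
  (* From [2 < r^2 (1 - c)] and [r^2 (1 - c) (1 + c) < b^2] follows [4 - b^2 < 2 (1 - c)]; times
     [r], this contradicts the bound [B] for large [r]. *)
  exists (2 * Rabs B / (4 - b ^ 2)). intros r rB c s cs ck Hs HB.
  assert (B0 := Rabs_pos B).
  assert (r0 : 0 < r).
  { eapply Rle_lt_trans; [|exact rB]. apply Rdiv_le_0_compat; lra. }
  assert (rb : 2 * Rabs B < r * (4 - b ^ 2)).
  { replace (2 * Rabs B) with (2 * Rabs B / (4 - b ^ 2) * (4 - b ^ 2))
      by (field; lra). now apply Rmult_lt_compat_r. }
  assert (u2 : 2 < r ^ 2 * (1 - c)).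
  { replace 2 with (r ^ 2 * (2 / r ^ 2)) by (field; lra).
    apply Rmult_lt_compat_l; [nra|lra]. }
  assert (w2 : (r * s) ^ 2 < b ^ 2).
  { rewrite <- (pow2_abs (r * s)).
    assert (Rabs (r * s) < b).
    { generalize (Rabs_triang_inv (r * s) y). unfold b. lra. }
    generalize (Rabs_pos (r * s)). nra. }
  assert (E : (r * s) ^ 2 = r ^ 2 * (1 - c) * (1 + c)).
  { replace ((r * s) ^ 2) with (r ^ 2 * s ^ 2) by ring.
    replace (s ^ 2) with (1 - c ^ 2) by lra. ring. }
  assert (uB : r * (1 - c) < Rabs B).
  { apply Rabs_lt_between in HB. generalize (Rle_abs B). lra. }
  assert (c1 : -1 <= c) by nra.
  assert (r * (4 - b ^ 2) < r * (2 * (1 - c))); [|nra].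
  apply Rmult_lt_compat_l; [exact r0|]. nra.
Qed.

Lemma dom_minus_cut (r0 : R) :
  cut_by (dom_minus r0) (fun r => r0 <= r) (fun r => 1 - 2 / r ^ 2).
Proof.
intros r c s cs; split.
- intros (v & [H1 H2] & <- & <-). now split.
- intros [H1 H2]. destruct (polar_angle c s cs) as (v & _ & <- & <-).
  now exists v.
Qed.

Lemma dom_minus_full_cut (r0 : R) :
  cut_by (dom_minus_full r0) (fun r => r0 <= r) (fun _ => 2).
Proof.
intros r c s cs; split.
- intros (v & H1 & <- & <-). split; [exact H1|]. generalize (COS_bound v); lra.
- intros [H1 _]. destruct (polar_angle c s cs) as (v & _ & <- & <-).
  now exists v.
Qed.

Lemma minus_bound (r : R) : 1 < r -> -1 < 1 - 2 / r ^ 2 <= 1.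
Proof.
intros r1. assert (0 < / r ^ 2) by (apply Rinv_0_lt_compat; nra).
assert (/ r ^ 2 < 1) by (rewrite <- Rinv_1; apply Rinv_lt_contravar; nra).
unfold Rdiv; lra.
Qed.

Lemma minus_sign (r c : R) : 0 < r ->
  r ^ 2 * (1 - c) + 2 * (-1) = r ^ 2 * (1 - 2 / r ^ 2 - c).
Proof. intros r0. field. lra. Qed.

(** * Interior and boundary of the parameter domains *)

Lemma dom_plus_interior (r v : R) : 0 < r -> 0 < v < 2 * PI ->
  locally ((r, v) : R * R) (fun w : R * R => dom_plus (fst w) (snd w)).
Proof.
intros r0 [v0 v1].
assert (d0 : 0 < Rmin r (Rmin v (2 * PI - v))) by (repeat apply Rmin_pos; lra).
exists (mkposreal _ d0). intros [u w] [Hu Hw]. cbn [fst snd] in *.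
apply Rabs_lt_between' in Hu, Hw. cbn [pos] in Hu, Hw.
generalize (Rmin_l r (Rmin v (2 * PI - v))), (Rmin_r r (Rmin v (2 * PI - v))),
  (Rmin_l v (2 * PI - v)), (Rmin_r v (2 * PI - v)).
unfold dom_plus. intros; repeat split; lra.
Qed.

Lemma cos_locally_lt (v k : R) : cos v < k -> locally v (fun w => cos w < k).
Proof. intros H. exact (continuous_cos v _ (open_lt k _ H)). Qed.

(** Points of the domain beyond the edge are interior by hypothesis, and at the edge [r = r0]
    slightly smaller radii leave the domain. *)
Lemma surface_boundary_iff (X : R -> R -> V3) (D : R -> R -> Prop) (r0 : R) :
  (forall r v, D r v -> r0 <= r) ->
  (forall r v, D r v -> r0 < r ->
     locally ((r, v) : R * R) (fun w : R * R => D (fst w) (snd w))) ->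
  forall p, surface_boundary X D p <-> exists v, D r0 v /\ p = X r0 v.
Proof.
intros HD Hint p. split.
- intros (r & v & Drv & N & ->). destruct (HD r v Drv) as [H|H].
  + now destruct N; apply Hint.
  + subst r. now exists v.
- intros (v & Drv & ->). exists r0, v. split; [exact Drv|split; [|reflexivity]].
  intros [d Hd]. assert (d0 := cond_pos d).
  assert (H : D (r0 - d / 2) v); [|apply HD in H; lra].
  apply (Hd (r0 - d / 2, v)). split; cbn [fst snd].
  + apply Rabs_lt_between'. lra.
  + apply ball_center.
Qed.

Lemma dom_minus_interior (r0 r v : R) : 1 < r0 -> dom_minus r0 r v -> r0 < r ->
  locally ((r, v) : R * R) (fun w : R * R => dom_minus r0 (fst w) (snd w)).
Proof.
intros r1 [_ H] Hr. set (k := 1 - 2 / r ^ 2) in *.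
(* A value strictly between the cosine and its bound, which keeps them apart when [v] and [r] vary
   independently. *)
set (m := (cos v + k) / 2).
destruct (cos_locally_lt v m ltac:(unfold m; lra)) as [d Hd].
assert (Hk : continuous (fun u => 1 - 2 / u ^ 2) r).
{ apply (ex_derive_continuous (V := R_NormedModule)). auto_derive. nra. }
destruct (Hk _ (open_gt m k ltac:(unfold m; lra))) as [d' Hd'].
assert (d0 : 0 < Rmin (Rmin d d') (r - r0)).
{ repeat apply Rmin_pos; [apply cond_pos|apply cond_pos|lra]. }
assert (m1 := Rmin_l (Rmin d d') (r - r0)).
assert (m2 := Rmin_r (Rmin d d') (r - r0)).
assert (m3 := Rmin_l d d'). assert (m4 := Rmin_r d d').
exists (mkposreal _ d0). intros [u w] [Hu Hw]. cbn [fst snd] in *.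
assert (Hu' : ball r d' u) by (eapply ball_le; [|exact Hu]; cbn [pos]; lra).
assert (Hw' : ball v d w) by (eapply ball_le; [|exact Hw]; cbn [pos]; lra).
split.
- apply Rabs_lt_between' in Hu. cbn [pos] in Hu. lra.
- exact (Rlt_trans _ _ _ (Hd w Hw') (Hd' u Hu')).
Qed.

Lemma dom_minus_full_interior (r0 r v : R) : r0 < r ->
  locally ((r, v) : R * R) (fun w : R * R => dom_minus_full r0 (fst w) (snd w)).
Proof.
intros Hr. assert (d0 : 0 < r - r0) by lra.
exists (mkposreal _ d0). intros [u w] [Hu _]. cbn [fst snd] in *.
apply Rabs_lt_between' in Hu. cbn [pos] in Hu. unfold dom_minus_full. lra.
Qed.

(** * Asymptotic plane and heights of limit lines *)

Lemma norm_V3_le (p : V3) : norm p <= Rabs (x1 p) + Rabs (x2 p) + Rabs (x3 p).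
Proof.
assert (H : forall a b, 0 <= a -> 0 <= b -> sqrt (a ^ 2 + b ^ 2) <= a + b).
{ intros a b a0 b0. rewrite <- (sqrt_pow2 (a + b)) by lra.
  apply sqrt_le_1_alt. nra. }
destruct p as [[p1 p2] p3]. unfold x1, x2, x3; cbn [fst snd].
eapply Rle_trans; [apply (H (norm (p1, p2)) (norm p3)); apply norm_ge_0|].
apply Rplus_le_compat; [|apply Rle_refl].
apply (H (norm p1) (norm p2)); apply norm_ge_0.
Qed.

Lemma norm_V3_ge (p : V3) : Rabs (x1 p) <= norm p.
Proof.
assert (H : forall a b, 0 <= a -> a <= sqrt (a ^ 2 + b ^ 2)).
{ intros a b a0. rewrite <- (sqrt_pow2 a) at 1 by lra.
  apply sqrt_le_1_alt. generalize (pow2_ge_0 b); lra. }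
destruct p as [[p1 p2] p3]. unfold x1; cbn [fst snd].
eapply Rle_trans; [|apply (H (norm (p1, p2)) (norm p3)), norm_ge_0].
apply (H (norm p1) (norm p2)), norm_ge_0.
Qed.

(** The norm on the circle of radius [r] is at most [4 r], so a large norm forces a large radius and
    hence a height close to [PI / 2]. Unboundedness is seen at [v = PI], where
    [x1 = atan r - 2 r]. *)
Lemma plus_asymptotic :
  asymptotic_to (image (RX 1 atan) dom_plus) (fun p => x3 p = PI / 2).
Proof.
assert (P := PI_RGT_0). split.
- intros M. set (r := Rmax M 1).
  assert (M1 := Rmax_l M 1). assert (M2 := Rmax_r M 1). fold r in M1, M2.
  exists (RX 1 atan (r + 1) PI). split.
  + exists (r + 1), PI. split; [|reflexivity]. split; lra.
  + eapply Rlt_le_trans; [|apply norm_V3_ge].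
    change (x1 (RX 1 atan (r + 1) PI)) with
      (1 * atan (r + 1) - (r + 1) + (r + 1) * cos PI).
    rewrite cos_PI. destruct (atan_bounds (r + 1) ltac:(lra)) as [_ H].
    rewrite Rabs_left1 by lra. lra.
- intros eps e0.
  destruct (z_limit _ _ _ _ _ profile_plus inverse_profile_plus eps e0) as [N HN].
  exists (4 * Rabs N + 4). intros p Sp Hp.
  exists (x1 p, x2 p, PI / 2). split; [reflexivity|].
  apply image_plus_iff in Sp. destruct Sp as (r & c & s & r0 & cs & c1 & ->).
  destruct (atan_bounds r r0) as [_ H].
  assert (H0 : 0 < atan r) by (rewrite <- atan_0; now apply atan_increasing).
  assert (rN : N < r).
  { assert (Hn := norm_V3_le (atan r - r + r * c, r * s, atan r)).
    unfold x1, x2, x3 in Hn; cbn [fst snd] in Hn.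
    assert (-1 <= c <= 1) by nra. assert (-1 <= s <= 1) by nra.
    assert (Rabs (atan r - r + r * c) <= 2 * r) by (apply Rabs_le_between; nra).
    assert (Rabs (r * s) <= r) by (apply Rabs_le_between; nra).
    assert (Rabs (atan r) <= r) by (apply Rabs_le_between; nra).
    generalize (Rle_abs N), (Rabs_pos N). lra. }
  apply ball_coord. unfold x1, x2, x3; cbn [fst snd].
  rewrite !Rminus_diag, Rabs_R0. repeat split; try exact e0.
  rewrite Rabs_minus_sym. now apply HN.
Qed.

(** [image_with_limit_lines] admits every limit line, so the slab estimate needs the height of an
    arbitrary one: its points are approximated by circles of large radius, whose heights tend to
    [h1]. *)
Lemma limit_line_height (e h1 : R) (z : R -> R) (D : R -> R -> Prop)
    (L : V3 -> Prop) (p : V3) :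
  (forall eps, 0 < eps ->
     Rbar_locally p_infty (fun r => Rabs (z r - h1) < eps)) ->
  limit_line (RX e z) D L -> L p -> x3 p = h1.
Proof.
intros Hz [_ [HL _]] Lp. apply Rminus_diag_uniq.
destruct (Req_dec (x3 p - h1) 0) as [E|E]; [exact E|exfalso].
set (d := Rabs (x3 p - h1)). assert (d0 : 0 < d) by now apply Rabs_pos_lt.
destruct (HL p Lp (d / 2) ltac:(lra)) as [M1 H1].
destruct (Hz (d / 2) ltac:(lra)) as [M2 H2].
set (r := Rmax M1 M2 + 1).
assert (r1 : M1 < r) by (generalize (Rmax_l M1 M2); unfold r; lra).
assert (r2 : M2 < r) by (generalize (Rmax_r M1 M2); unfold r; lra).
destruct (H1 r r1) as (q & (v & _ & ->) & Hq). specialize (H2 r r2).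
apply ball_coord in Hq. destruct Hq as (_ & _ & Hq).
change (x3 (RX e z r v)) with (z r) in Hq. rewrite Rabs_minus_sym in Hq.
generalize (Rabs_triang (x3 p - z r) (z r - h1)).
replace (x3 p - z r + (z r - h1)) with (x3 p - h1) by ring. fold d. lra.
Qed.

Lemma limit_line_in_surface (e h1 b : R) (z : R -> R) (D : R -> R -> Prop)
    (I : R -> Prop) (k : R -> R) :
  cut_by D I k -> (forall r, b < r -> I r) ->
  set_converges (arc e z k) (Rbar_locally p_infty)
    (limit_set e h1 (fun _ => True)) ->
  forall p, limit_set e h1 (fun _ => True) p ->
    image_with_limit_lines (RX e z) D p.
Proof.
intros HD Hb HL p Lp. right. exists (limit_set e h1 (fun _ => True)).
split; [|exact Lp]. split.
- exists (e * h1, 0, h1), (0, 1, 0). split; [exact e2_neq_0|apply limit_set_line].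
- exact (slices_converge e b z D I k _ HD Hb HL).
Qed.

Theorem theorem3p3 :
  spacelike_subspace horizontal /\
  (* lambda = 2 *)
  ( family_member 2 (fun q => 0 < q) X_plus /\
    riemann_zmc_example X_plus dom_plus /\
    (forall r v : R, dom_plus r v -> spacelike_at X_plus r v) /\
    (* (a) *)
    (forall p : V3, image X_plus dom_plus p ->
       is_punctured_hcircle (leaf (image X_plus dom_plus) (x3 p))) /\
    (* (b) *)
    (forall p : V3, image_with_limit_lines X_plus dom_plus p ->
       0 < x3 p <= PI / 2) /\
    (* (c) *)
    (exists p : V3,
       converges_to_conelike_point (image X_plus dom_plus) 0 p) /\
    (exists L : V3 -> Prop,
       is_line_orthogonal_to plane_Pi L /\
       set_converges (leaf (image X_plus dom_plus)) (at_left (PI / 2)) L /\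
       (forall p : V3, L p -> image_with_limit_lines X_plus dom_plus p)) /\
    (* (d) *)
    asymptotic_to (image X_plus dom_plus) (fun p => x3 p = PI / 2) /\
    (* (e) *)
    ( smooth_map X_plus dom_plus_full /\
      (forall r v : R, dom_plus_full r v -> immersed_at X_plus r v) /\
      exists L : V3 -> Prop,
        is_lightlike_line L /\
        (forall r v : R, dom_plus_full r v -> cos v = 1 ->
           L (X_plus r v) /\ degenerate_at X_plus r v) ) ) /\
  (* lambda = -2 *)
  ( family_member (-2) (fun q => 1 < q) X_minus /\
    forall r0 : R, 1 < r0 ->
    riemann_zmc_example X_minus (dom_minus r0) /\
    (forall r v : R, dom_minus r0 r v -> spacelike_at X_minus r v) /\
    (* (a) *)
    ( (forall p : V3, image X_minus (dom_minus r0) p ->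
         is_hcircle_arc (leaf (image X_minus (dom_minus r0)) (x3 p)) /\
         is_hcircle (leaf (image X_minus (dom_minus_full r0)) (x3 p))) /\
      smooth_map X_minus (dom_minus_full r0) /\
      (forall r v : R, dom_minus_full r0 r v ->
         immersed_at X_minus r v /\
         (cos v = 1 - 2 / r ^ 2 -> degenerate_at X_minus r v) /\
         (1 - 2 / r ^ 2 < cos v -> cos v <> 1 ->
            timelike_at X_minus r v /\ mean_curvature X_minus r v = 0) /\
         (cos v = 1 -> degenerate_at X_minus r v)) ) /\
    (* (b) *)
    (forall p : V3, image X_minus (dom_minus_full r0) p ->
       / 2 * ln ((r0 - 1) / (r0 + 1)) <= x3 p < 0) /\
    (* (c) *)
    ( is_hcircle_arc (surface_boundary X_minus (dom_minus r0)) /\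
      (forall p : V3, surface_boundary X_minus (dom_minus r0) p <->
         exists v : R, dom_minus r0 r0 v /\ p = X_minus r0 v) /\
      is_hcircle (surface_boundary X_minus (dom_minus_full r0)) /\
      (forall p : V3, surface_boundary X_minus (dom_minus_full r0) p <->
         exists v : R, p = X_minus r0 v) ) /\
    (exists L : V3 -> Prop,
       is_line_orthogonal_to plane_Pi L /\
       set_converges (leaf (image X_minus (dom_minus_full r0))) (at_left 0) L /\
       (forall p : V3, L p ->
          image_with_limit_lines X_minus (dom_minus_full r0) p) /\
       set_converges (leaf (image X_minus (dom_minus r0))) (at_left 0)
         (fun p => L p /\ 2 <= Rabs (x2 p))) ).
Proof.
rewrite X_plus_RX, X_minus_RX.
assert (P := PI_RGT_0).
split; [|split].
- intros w w0 wn. destruct w as [[w1 w2] w3]. unfold horizontal, x3 in w0.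
  cbn [fst snd] in w0. subst w3. unfold lor, x1, x2, x3; cbn [fst snd].
  destruct (Req_dec w1 0) as [->|n1]; [destruct (Req_dec w2 0) as [->|n2]|].
  + now destruct wn.
  + nra.
  + nra.
- assert (Hz := profile_plus). assert (HR := inverse_profile_plus).
  assert (HD := dom_plus_cut).
  assert (c1 : forall r v, dom_plus r v -> cos v < 1).
  { intros r v Hrv.
    apply (HD r (cos v) (sin v) (cos2_plus_sin2 v)). now exists v. }
  assert (pos : forall r v, dom_plus r v -> 0 < r ^ 2 * (1 - cos v) + 2 * 1).
  { intros r v Hrv. assert (H := c1 r v Hrv). assert (0 <= r ^ 2) by apply pow2_ge_0.
    nra. }
  assert (conv := converge_punctured _ _ _ _ _ Hz HR).
  split; [|split; [|split; [|split; [|split; [|split; [|split; [|split]]]]]]].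
  + replace 2 with (2 * 1) by ring. apply (RX_family_member 1 0 atan _ Hz).
    intros q q0. split; [exact q0|now apply sqrt_lt_R0].
  + apply (RX_riemann 1 0 (PI / 2) atan tan dom_plus (fun r => 0 < r)
      (fun _ => 1) 1 2); auto; try (intros; lra); [intros; split; eauto|].
    intros r v Hr Hv _. apply dom_plus_interior; [destruct Hr; lra|exact Hv].
  + intros r v Hrv. apply (RX_spacelike 1 0); eauto. apply Hrv.
  + intros p Sp. destruct (image_height _ _ _ _ _ p HD Sp) as (r & r0 & ->).
    apply (punctured_arc_is_punctured_hcircle 1 atan r); [exact r0|].
    intros q. apply (leaf_arc 1 0 atan _ (fun r => 0 < r)); auto.
  + intros p [Sp|(L & HL & Lp)].
    * destruct (image_height _ _ _ _ _ p HD Sp) as (r & r0 & ->).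
      destruct (atan_bound r). split; [|lra].
      rewrite <- atan_0. now apply atan_increasing.
    * rewrite (limit_line_height 1 (PI / 2) atan dom_plus L p); auto; [lra|].
      exact (z_limit _ _ _ _ _ Hz HR).
  + exists (0, 0, 0). split; [exact conelike_shrink|exact cone_blow_up].
  + exists (limit_set 1 (PI / 2) (fun _ => True)).
    split; [apply limit_set_orthogonal|split].
    * apply (leaves_converge 1 0 (PI / 2) 0 atan tan dom_plus (fun r => 0 < r)
        (fun _ => 1)); auto.
    * apply (limit_line_in_surface 1 (PI / 2) 0 atan dom_plus (fun r => 0 < r)
        (fun _ => 1)); auto.
  + exact plus_asymptotic.
  + split; [now apply (RX_smooth 1 0)|split].
    { intros r v r0. now apply (RX_immersed 1 0). }
    (* At [cos v = 1] the radius cancels in [x1], leaving [(atan r, 0, atan r)]. *)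
    exists (line (0, 0, 0) (1, 0, 1)). split.
    * exists (0, 0, 0), (1, 0, 1). split; [|split].
      -- intros H. apply (f_equal x1) in H. change (1 = 0) in H. lra.
      -- unfold lor, x1, x2, x3; cbn [fst snd]; ring.
      -- tauto.
    * intros r v r0 cv. split.
      -- exists (atan r). rewrite plus_scal_coord.
         assert (sv : sin v = 0).
         { generalize (cos2_sin2 v). rewrite cv. nra. }
         apply V3_eq; unfold RX, x1, x2, x3; cbn [fst snd]; rewrite ?cv, ?sv; ring.
      -- apply (RX_degenerate_iff 1 0); auto. rewrite cv. ring.
- assert (Hz := profile_minus). assert (HR := inverse_profile_minus).
  split.
  { replace (-2) with (2 * (-1)) by ring. apply (RX_family_member (-1) 1 _ _ Hz).
    intros q q1. split; [lra|]. rewrite <- sqrt_1. apply sqrt_lt_1; lra. }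
  intros r0 r01. assert (HD := dom_minus_cut r0). assert (HF := dom_minus_full_cut r0).
  assert (HI : forall r, r0 <= r -> 1 < r) by (intros; lra).
  assert (Hk : forall r, r0 <= r -> -1 < 1 - 2 / r ^ 2 <= 1).
  { intros r H. apply minus_bound; lra. }
  assert (Hdef : forall r v, dom_minus r0 r v ->
    cos v < 1 /\ 0 < r ^ 2 * (1 - cos v) + 2 * (-1)).
  { intros r v [H1 H2]. assert (H3 := Hk r H1). split; [lra|].
    rewrite minus_sign by lra. apply Rmult_lt_0_compat; [nra|lra]. }
  assert (Hb : forall r, r0 < r -> r0 <= r) by (intros; lra).
  assert (Bd := surface_boundary_iff (RX (-1) z_minus) (dom_minus r0) r0
    (fun r v H => proj1 H) (fun r v H => dom_minus_interior r0 r v r01 H)).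
  assert (Bf := surface_boundary_iff (RX (-1) z_minus) (dom_minus_full r0) r0
    (fun r v H => H) (fun r v _ => dom_minus_full_interior r0 r v)).
  assert (conv := converge_full _ _ _ _ _ Hz HR).
  split; [|split; [|split; [|split; [|split]]]].
  (* Both radii exceed 2, so [1 - 2 / r^2 > 0] and the half circles [cos v <= 0] lie in the domain;
     they also exceed [r0], which keeps them off its edge. *)
  + apply (RX_riemann (-1) 1 0 z_minus z_minus_inv (dom_minus r0)
      (fun r => r0 <= r) (fun r => 1 - 2 / r ^ 2) (r0 + 1) (r0 + 2)); auto; try lra.
    intros r v Hr Hv cv. assert (Hr' : r0 + 1 <= r) by (destruct Hr; lra).
    apply dom_minus_interior; [exact r01| |lra].
    split; [lra|].
    assert (2 / r ^ 2 < 1); [|lra].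
    apply (Rmult_lt_reg_r (r ^ 2)); [nra|]. unfold Rdiv.
    rewrite Rmult_assoc, Rinv_l by nra. nra.
  + intros r v Hrv. destruct (Hdef r v Hrv).
    apply (RX_spacelike (-1) 1); auto. apply HI, Hrv.
  + split; [|split].
    * intros p Sp. split.
      -- apply (leaf_is_hcircle_arc (-1) 1 z_minus _ (fun r => r0 <= r)
           (fun r => 1 - 2 / r ^ 2)); auto.
      -- destruct (image_height _ _ _ _ _ p HD Sp) as (r & Ir & ->).
         apply (full_arc_is_hcircle (-1) z_minus r); [lra|].
         intros q. apply (leaf_arc (-1) 1 z_minus _ (fun r => r0 <= r)); auto.
    * apply (RX_smooth (-1) 1); auto.
    * intros r v Hr. assert (r1 : 1 < r) by exact (HI r Hr).
      split; [now apply (RX_immersed (-1) 1)|split; [|split]].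
      -- intros E. apply (RX_degenerate_iff (-1) 1); auto.
         rewrite minus_sign, E by lra. ring.
      -- intros H1 H2. assert (cos v < 1) by (generalize (COS_bound v); lra).
         split; [|now apply (RX_minimal (-1) 1)].
         apply (RX_timelike (-1) 1); auto.
         rewrite minus_sign by lra. assert (0 < r ^ 2) by nra. nra.
      -- intros E. apply (RX_degenerate_iff (-1) 1); auto. rewrite E. ring.
  + intros p Sp. destruct (image_height _ _ _ _ _ p HF Sp) as (r & Ir & ->).
    split; [|now apply (HR r), HI].
    destruct Ir as [Ir| <-]; [|apply Rle_refl].
    left. apply (z_increasing (-1) 1 z_minus); auto.
  + split; [|split; [|split]].
    * apply (arc_is_hcircle_arc (-1) z_minus (fun r => 1 - 2 / r ^ 2) r0);
        [lra|apply Hk; lra|].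
      intros p. rewrite Bd, (slice_arc _ _ _ _ _ r0 p HD).
      split; [tauto|]. intros H; split; [lra|exact H].
    * exact Bd.
    * apply (full_arc_is_hcircle (-1) z_minus r0); [lra|].
      intros p. rewrite Bf, (slice_arc _ _ _ _ _ r0 p HF).
      split; [tauto|]. intros H; split; [lra|exact H].
    * intros p. rewrite Bf. unfold dom_minus_full.
      split; intros (v & H); exists v; [tauto|]. split; [lra|exact H].
  + exists (limit_set (-1) 0 (fun _ => True)).
    split; [apply limit_set_orthogonal|split; [|split]].
    * apply (leaves_converge (-1) 1 0 r0 z_minus z_minus_inv _ (fun r => r0 <= r)
        (fun _ => 2)); auto.
    * apply (limit_line_in_surface (-1) 0 r0 z_minus _ (fun r => r0 <= r)
        (fun _ => 2)); auto.
    * apply (set_converges_limit_ext _ _ (limit_set (-1) 0 (fun y => 2 <= Rabs y))).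
      { intros p. unfold limit_set. tauto. }
      apply (leaves_converge (-1) 1 0 r0 z_minus z_minus_inv _ (fun r => r0 <= r)
        (fun r => 1 - 2 / r ^ 2)); auto. exact converge_minus.
Qed.
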